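(* Let $A$ be a definite quaternion algebra over $\mathbb{Q}$ and let $\mathcal{O}$ be a maximal order of $A$. Then the euclidean space $\mathbb{H}\times\mathbb{H}$ contains $\mathcal{O}$-lattices which are isometric to $\mathrm{E}_8$.
   Context: $A$ definite means that $\mathbb{H}=A\otimes_{\mathbb{Q}}\mathbb{R}$ is Hamilton's quaternion algebra over $\mathbb{R}$; $A$ is viewed inside $\mathbb{H}$. Write $x\mapsto\overline{x}$ and $\mathtt{tr}$ for the conjugation and reduced trace of $\mathbb{H}$. The space $\mathbb{H}\times\mathbb{H}$ is a right $\mathbb{H}$-vector space, endowed with the euclidean scalar product $(x,y)\cdot(x',y')=\mathtt{tr}(\overline{x}\,x')+\mathtt{tr}(\overline{y}\,y')$. An $\mathcal{O}$-lattice of $\mathbb{H}\times\mathbb{H}$ is a $\mathbb{Z}$-lattice of $\mathbb{H}\times\mathbb{H}$ which is moreover a free submodule of rank $2$ of the right $\mathcal{O}$-module $\mathbb{H}\times\mathbb{H}$. $\mathrm{E}_8$ denotes the $E_8$ root lattice (with roots satisfying $x\cdot x=2$), the unique even unimodular euclidean lattice of rank $8$ up to isometry; isometric means isometric as euclidean $\mathbb{Z}$-lattices. *)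

(* Defs.v *)
From HB Require Import structures.
From mathcomp Require Import all_boot all_order all_algebra all_field.
From mathcomp Require Import boolp classical_sets functions reals.
From mathcomp Require Import ring.

Set Implicit Arguments.
Unset Strict Implicit.
Unset Printing Implicit Defensive.

Import Order.TTheory GRing.Theory Num.Theory.

Local Open Scope classical_set_scope.
Local Open Scope ring_scope.

(* Quat a b c d is a + b i + c j + d k. *)
Record quat (R : realFieldType) :=
  Quat { qre : R; qi : R; qj : R; qk : R }.

Section QuatAlgebra.
Variable R : realFieldType.
Implicit Types (x y z : quat R) (a b : R).

Definition quat_tuple x : R * R * R * R := (qre x, qi x, qj x, qk x).
Definition tuple_quat (t : R * R * R * R) : quat R :=
  Quat t.1.1.1 t.1.1.2 t.1.2 t.2.

Lemma quat_tupleK : cancel quat_tuple tuple_quat.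
Proof. by case. Qed.

HB.instance Definition _ := Choice.copy (quat R) (can_type quat_tupleK).

Lemma quatP x y :
  qre x = qre y -> qi x = qi y -> qj x = qj y -> qk x = qk y -> x = y.
Proof. by case: x => ? ? ? ?; case: y => ? ? ? ? /= -> -> -> ->. Qed.

Definition quat_zero : quat R := Quat 0 0 0 0.
Definition quat_one : quat R := Quat 1 0 0 0.
Definition quat_opp x := Quat (- qre x) (- qi x) (- qj x) (- qk x).
Definition quat_add x y :=
  Quat (qre x + qre y) (qi x + qi y) (qj x + qj y) (qk x + qk y).
Definition quat_scale a x := Quat (a * qre x) (a * qi x) (a * qj x) (a * qk x).
Definition quat_mul x y :=
  Quat (qre x * qre y - qi x * qi y - qj x * qj y - qk x * qk y)
       (qre x * qi y + qi x * qre y + qj x * qk y - qk x * qj y)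
       (qre x * qj y - qi x * qk y + qj x * qre y + qk x * qi y)
       (qre x * qk y + qi x * qj y - qj x * qi y + qk x * qre y).

Lemma quat_addA : associative quat_add.
Proof. by move=> x y z; apply: quatP; rewrite /= addrA. Qed.
Lemma quat_addC : commutative quat_add.
Proof. by move=> x y; apply: quatP; rewrite /= addrC. Qed.
Lemma quat_add0 : left_id quat_zero quat_add.
Proof. by move=> x; apply: quatP; rewrite /= add0r. Qed.
Lemma quat_addN : left_inverse quat_zero quat_opp quat_add.
Proof. by move=> x; apply: quatP; rewrite /= addNr. Qed.
HB.instance Definition _ :=
  GRing.isZmodule.Build (quat R) quat_addA quat_addC quat_add0 quat_addN.

Lemma quat_mulA : associative quat_mul.
Proof. by move=> x y z; apply: quatP => /=; ring. Qed.
Lemma quat_mul1l : left_id quat_one quat_mul.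
Proof. by move=> x; apply: quatP => /=; ring. Qed.
Lemma quat_mul1r : right_id quat_one quat_mul.
Proof. by move=> x; apply: quatP => /=; ring. Qed.
Lemma quat_mulDl : left_distributive quat_mul quat_add.
Proof. by move=> x y z; apply: quatP => /=; ring. Qed.
Lemma quat_mulDr : right_distributive quat_mul quat_add.
Proof. by move=> x y z; apply: quatP => /=; ring. Qed.
Lemma quat_one_neq0 : quat_one != 0.
Proof. by apply/eqP => -[] /eqP; rewrite oner_eq0. Qed.
HB.instance Definition _ := GRing.Zmodule_isNzRing.Build (quat R)
  quat_mulA quat_mul1l quat_mul1r quat_mulDl quat_mulDr quat_one_neq0.

Lemma quat_scaleA a b x : quat_scale a (quat_scale b x) = quat_scale (a * b) x.
Proof. by apply: quatP; rewrite /= mulrA. Qed.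
Lemma quat_scale1 : left_id 1 quat_scale.
Proof. by move=> x; apply: quatP; rewrite /= mul1r. Qed.
Lemma quat_scaleDr : right_distributive quat_scale +%R.
Proof. by move=> a x y; apply: quatP; rewrite /= mulrDr. Qed.
Lemma quat_scaleDl x : {morph quat_scale^~ x : a b / a + b}.
Proof. by move=> a b; apply: quatP; rewrite /= mulrDl. Qed.
HB.instance Definition _ := GRing.Zmodule_isLmodule.Build R (quat R)
  quat_scaleA quat_scale1 quat_scaleDr quat_scaleDl.

Lemma quat_scaleAl a x y : a *: (x * y) = (a *: x) * y.
Proof. by apply: quatP => /=; ring. Qed.
HB.instance Definition _ := GRing.Lmodule_isLalgebra.Build R (quat R) quat_scaleAl.
Lemma quat_scaleAr a x y : a *: (x * y) = x * (a *: y).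
Proof. by apply: quatP => /=; ring. Qed.
HB.instance Definition _ := GRing.Lalgebra_isAlgebra.Build R (quat R) quat_scaleAr.

Definition quat_row x : 'rV[R]_4 :=
  \row_(i < 4) [:: qre x; qi x; qj x; qk x]`_i.
Lemma quat_vect_axiom : Vector.axiom 4 (quat R).
Proof.
exists quat_row.
  by move=> a x y; apply/rowP => -[[|[|[|[|//]]]] lti]; rewrite !mxE.
exists (fun v : 'rV_4 => Quat (v 0 0) (v 0 1) (v 0 2%:R) (v 0 3%:R)) => [x|v].
  by apply: quatP; rewrite /= !mxE.
apply/rowP => -[[|[|[|[|//]]]] lti]; rewrite !mxE /=; congr (v _ _);
  exact: val_inj.
Qed.
HB.instance Definition _ := Lmodule_hasFinDim.Build R (quat R) quat_vect_axiom.
HB.instance Definition _ := Algebra_isFalgebra.Build R (quat R).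

Definition qconj x := Quat (qre x) (- qi x) (- qj x) (- qk x).

(* The reduced trace x + conj x lies in R; it is read off its real part. *)
Definition qtrace x : R := qre (x + qconj x).

End QuatAlgebra.

(* H x H as a right H-vector space; the product type also carries the
   componentwise left R-vector space structure, which agrees with the right
   action of the scalar quaternions. *)
Notation HH R := (quat R * quat R)%type.

Definition HHscale (R : realFieldType) (v : HH R) (h : quat R) : HH R :=
  (v.1 * h, v.2 * h).

Definition HHdot (R : realFieldType) (v w : HH R) : R :=
  qtrace (qconj v.1 * w.1) + qtrace (qconj v.2 * w.2).

(* Central simple of dimension 4. Two-sided ideals of a unital F-algebra are
   F-subspaces, so they are quantified as such. *)
Definition quaternion_algebra (F : fieldType) (A : falgType F) : Prop :=
  [/\ \dim {:A} = 4%N,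
      ('Z({:A}) = 1)%VS
    & forall I : {vspace A}, ({:A} * I <= I)%VS -> (I * {:A} <= I)%VS ->
        I = 0%VS \/ I = fullv].

(* The universal property of a |-> a (x) 1 : A -> A (x)_Q R: iota identifies
   A (x)_Q R with B, i.e. every Q-linear map g from A to an R-vector space
   factors through iota by a unique R-linear map. A ring morphism between
   Q-algebras being Q-linear, iota need not be assumed so. *)
Definition scalar_extension (R : realFieldType) (A : falgType rat)
    (B : algType R) (iota : {rmorphism A -> B}) : Prop :=
  forall (V : lmodType R) (g : {linear A -> V | ratr \; *:%R}),
    exists h : {linear B -> V},
      h \o iota =1 g /\
      forall h' : {linear B -> V}, h' \o iota =1 g -> h' =1 h.

(* The Z-span of a basis of the whole space. *)
Definition zlattice (F : numFieldType) (V : vectType F) (L : set V) : Prop :=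
  exists b : (\dim {:V}).-tuple V,
    basis_of fullv b /\ L = [set v | inIntSpan b v].

Definition is_order (A : falgType rat) (O : set A) : Prop :=
  [/\ zlattice O, O 1 & forall x y, O x -> O y -> O (x * y)].

Definition maximal_order (A : falgType rat) (O : set A) : Prop :=
  is_order O /\ forall O' : set A, is_order O' -> O `<=` O' -> O' = O.

(* e is an O-basis of L, for O acting on the right of H x H through iota. *)
Definition free_submodule (R : realFieldType) (A : falgType rat)
    (iota : {rmorphism A -> quat R}) (O : set A) (n : nat)
    (L : set (HH R)) : Prop :=
  exists e : 'I_n -> HH R,
    L = [set v | exists2 a : 'I_n -> A, forall i, O (a i)
                 & v = \sum_(i < n) HHscale (e i) (iota (a i))] /\
    forall a : 'I_n -> A, (forall i, O (a i)) ->
      \sum_(i < n) HHscale (e i) (iota (a i)) = 0 -> forall i, a i = 0.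

Definition O_lattice (R : realFieldType) (A : falgType rat)
    (iota : {rmorphism A -> quat R}) (O : set A) (L : set (HH R)) : Prop :=
  zlattice L /\ free_submodule iota O 2 L.

Definition dot (R : realFieldType) (n : nat) (x y : 'rV[R]_n) : R :=
  (x *m y^T) 0 0.

(* D8+, with roots +-e_i+-e_j and (+-1/2,...,+-1/2) with an even number of
   minus signs. *)
Definition E8 (R : realType) : set 'rV[R]_8 :=
  [set x : 'rV[R]_8 | ((forall i, x 0 i \is a Num.int) \/
            (forall i, x 0 i - 2^-1 \is a Num.int)) /\
           (\sum_i x 0 i) / 2 \is a Num.int].

Definition isometric (R : realFieldType) (V W : lmodType R)
    (dV : V -> V -> R) (dW : W -> W -> R) (L : set V) (M : set W) : Prop :=
  exists f : V -> W,
    [/\ set_bij L M f,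
        forall x y, L x -> L y -> f (x + y) = f x + f y
      & forall x y, L x -> L y -> dW (f x) (f y) = dV x y].

(* Main.v *)
Require Import Defs.
From HB Require Import structures.
From mathcomp Require Import all_boot all_order all_algebra all_field.
From mathcomp Require Import boolp classical_sets reals.
From mathcomp Require Import ring lra zify.

Set Implicit Arguments.
Unset Strict Implicit.
Unset Printing Implicit Defensive.

Import Order.TTheory GRing.Theory Num.Theory.

Local Open Scope ring_scope.

(** Why the theorem holds. Let tr and N be the reduced trace and norm of A, let
    O# be the dual of O for the trace pairing, and let d > 0 and b in O# be
    given. The vectors (1, 0) and (b, 1/sqrt d) of the quaternionic plane span
    over O the lattice of all (x + b y, y/sqrt d), whose quadratic form is
    2 (N(x + b y) + N(y)/d). If N(b) + 1/d is an integer the form is even; if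
    moreover d O# and d O# O# lie in O, the lattice is its own dual
    (tform_selfdual). It is then an even unimodular lattice of rank 8, and E8
    is the only one (even_unimodular8_E8).

    To find d and b. The key is that an element z of O# with integral norm lies
    in O (maximal_order_integral): z u z = tr(z u) z - N(z) conj(u) shows that
    O + O z O is a ring, hence an order. Let d be the exponent of O#/O. Applied
    to products of elements of O#, this gives d O# O# in O (dual_mul); applied
    to multiples, it shows that d is squarefree; and for a prime p
    dividing d it shows that an element of O with norm divisible by p is p
    times an element of O#. From this anisotropy, N represents every residue
    class modulo p (norm_surj_mod), so that d N(b) = -1 can be solved modulo p
    with b in O# (local_twist), and the solutions for the primes dividing d add
    up to a solution modulo d (partial_twist).

    Uniqueness of E8. Hermite's inequality produces, in the orthogonal
    complement of k < 8 pairwise orthogonal roots, a further root: the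
    determinant of the complement is 2^k divided by the square of an index, and
    this index is at least 2^(k-4) because the roots span an isotropic subspace
    modulo 2, of dimension at most 4 (orthogonal_lattice, orthogonal_root). So
    there are eight orthogonal roots. Those sums of roots which are divisible
    by 2 in the lattice form a code all of whose weights are multiples of 4, and
    among any five roots some four add up to a word. This forces the extended
    Hamming code (hamming_frame), hence coordinates of type D8+ (norm4_frame).

    Finally, the reduced trace of A is the trace of the real quaternions. It is
    rational because every linear functional on A extends to the quaternions,
    which is what scalar extension means (rational_trace). *)

(** * Gram forms and Hermite's inequality *)

Definition gdot (K : comNzRingType) n (G : 'M[K]_n) (x y : 'rV[K]_n) : K :=
  (x *m G *m y^T) 0 0.

Definition posdef (K : numDomainType) n (G : 'M[K]_n) :=
  G^T = G /\ forall x, x != 0 -> 0 < gdot G x x.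

Notation ratmx := (map_mx (intr : int -> rat)).

Section GramLemmas.
Variables (K : comNzRingType) (n : nat).
Implicit Types (G : 'M[K]_n) (x y z : 'rV[K]_n).

Lemma gdotDl G x y z : gdot G (x + y) z = gdot G x z + gdot G y z.
Proof. by rewrite /gdot !mulmxDl mxE. Qed.
Lemma gdotDr G x y z : gdot G x (y + z) = gdot G x y + gdot G x z.
Proof. by rewrite /gdot linearD /= mulmxDr mxE. Qed.
Lemma gdotZl G a x y : gdot G (a *: x) y = a * gdot G x y.
Proof. by rewrite /gdot -!scalemxAl mxE. Qed.
Lemma gdotZr G a x y : gdot G x (a *: y) = a * gdot G x y.
Proof. by rewrite /gdot linearZ /= -scalemxAr mxE. Qed.
Lemma gdotC G x y : G^T = G -> gdot G x y = gdot G y x.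
Proof.
move=> sG; rewrite /gdot -[in LHS](trmxK (x *m G *m y^T)) mxE.
by rewrite !trmx_mul trmxK sG mulmxA.
Qed.
Lemma gdot_mulmx m (P : 'M[K]_(m, n)) G (x y : 'rV_m) :
  gdot (P *m G *m P^T) x y = gdot G (x *m P) (y *m P).
Proof. by rewrite /gdot trmx_mul !mulmxA. Qed.
Lemma gram_entry m (P : 'M[K]_(m, n)) G i j :
  (P *m G *m P^T) i j = gdot G (row i P) (row j P).
Proof.
rewrite /gdot tr_row -!row_mul [in RHS]mxE !mxE.
by apply: eq_bigr => k _; rewrite !mxE.
Qed.
End GramLemmas.

(** Completing the square in the first variable: the Gram matrix of the
    projection of a lattice along its first basis vector is a Schur complement. *)
Lemma gdot_schur (K : fieldType) n (a : K) (w : 'rV[K]_n) (C : 'M[K]_n)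
    (t : K) (y : 'rV_n) : a != 0 ->
  gdot (block_mx a%:M w w^T C : 'M_(1 + n)) (row_mx t%:M y) (row_mx t%:M y) =
  a * (t + (w *m y^T) 0 0 / a) ^+ 2 + gdot (C - a^-1 *: (w^T *m w)) y y.
Proof.
move=> a0; rewrite /gdot tr_row_mx mul_row_block mul_row_col tr_scalar_mx.
rewrite !mulmxDl mulmxBr mulmxBl -scalemxAr -scalemxAl.
have -> : t%:M *m w *m y^T = (t * (w *m y^T) 0 0)%:M.
  by rewrite mul_scalar_mx -scalemxAl; apply/matrixP => i j; rewrite !ord1 !mxE mulr1n.
have yw : y *m w^T = ((w *m y^T) 0 0)%:M.
  by rewrite -[y]trmxK -trmx_mul trmxK; apply/matrixP => i j; rewrite !ord1 !mxE mulr1n.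
have -> : y *m (w^T *m w) *m y^T = ((w *m y^T) 0 0 ^+ 2)%:M.
  rewrite mulmxA yw mul_scalar_mx -scalemxAl.
  by apply/matrixP => i j; rewrite !ord1 !mxE mulr1n.
rewrite yw -!scalar_mxM !mxE /= !mulr1n.
by field.
Qed.

Lemma det_schur (K : fieldType) n (a : K) (w : 'rV[K]_n) (C : 'M[K]_n) :
  a != 0 ->
  \det (block_mx a%:M w w^T C : 'M_(1 + n)) =
  a * \det (C - a^-1 *: (w^T *m w)).
Proof.
move=> a0.
have -> : block_mx a%:M w w^T C =
  block_mx 1%:M 0 (a^-1 *: w^T) 1%:M *m
  block_mx a%:M w 0 (C - a^-1 *: (w^T *m w)) :> 'M_(1 + n).
  rewrite mulmx_block !mul1mx !mul0mx !addr0 -!scalemxAl.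
  by rewrite mul_mx_scalar scalerA mulVf // scale1r addrC subrK.
by rewrite det_mulmx det_lblock det_ublock !det1 !mul1r det_scalar expr1.
Qed.

Lemma ratmx_eq0 m n (x : 'M[int]_(m, n)) : (ratmx x == 0) = (x == 0).
Proof.
apply/eqP/eqP => [/matrixP x0|->]; last by rewrite map_mx0.
by apply/matrixP => i j; move: (x0 i j); rewrite !mxE => /eqP; rewrite intr_eq0 => /eqP.
Qed.

(** Induction on the rank. Take a vector of least norm [a] as first basis vector
    and project the lattice along it. A nonzero vector of the projection lifts to
    one whose component along the first vector has coefficient at most 1/2 in
    absolute value; as the lift has norm at least [a], the projected vector has
    norm at least 3a/4. *)
Lemma hermite_inequality n (G : 'M[rat]_n) (c : rat) : posdef G -> 0 <= c ->
  (forall x : 'rV[int]_n, x != 0 -> c <= gdot G (ratmx x) (ratmx x)) ->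
  c ^+ n * (3%:R / 4%:R) ^+ 'C(n, 2) <= \det G.
Proof.
elim: n => [|n IHn] in G c * => -[sG pG] c0 cG.
  by rewrite det_mx00 bin0n expr0 mulr1.
(* Clearing denominators puts the norms in the naturals, so a minimum exists. *)
pose D := \prod_i \prod_j denq (G i j).
have D0 : D != 0 by do 2!(apply/prodf_neq0 => ? _); rewrite denq_neq0.
have DG i j : exists z : int, D%:~R * G i j = z%:~R.
  rewrite /D (bigD1 i) //= (bigD1 j) //=.
  set A := \prod_(k | k != j) _; set B := \prod_(k | k != i) _.
  exists (A * B * numq (G i j)).
  rewrite -[X in _ * X = _](divq_num_den (G i j)) !intrM; field.
  by rewrite intr_eq0 denq_neq0.
have DQ (x : 'rV[int]_n.+1) : exists m : nat,
    `|D|%:~R * gdot G (ratmx x) (ratmx x) = m%:R.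
  have [z Dz] : exists z : int, D%:~R * gdot G (ratmx x) (ratmx x) = z%:~R.
    suff : D%:~R * gdot G (ratmx x) (ratmx x) \is a Num.int by move/intrP.
    rewrite /gdot mxE mulr_sumr; apply: rpred_sum => j _.
    rewrite mxE mulr_suml mulr_sumr; apply: rpred_sum => k _.
    have [z Ez] := DG k j.
    have -> : D%:~R * (ratmx x 0 k * G k j * (ratmx x)^T j 0)
      = ratmx x 0 k * (ratmx x)^T j 0 * (D%:~R * G k j) by ring.
    by rewrite Ez !mxE -!intrM intr_int.
  have Q0 : 0 <= gdot G (ratmx x) (ratmx x).
    have [->|x0] := eqVneq x 0; first by rewrite map_mx0 /gdot !mul0mx mxE.
    by rewrite ltW // pG // ratmx_eq0.
  exists `|z|%N; rewrite natr_absz intr_norm -[X in _ * X](ger0_norm Q0).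
  by rewrite intr_norm -normrM Dz.
have exm : exists m, `[< exists2 x : 'rV[int]_n.+1, x != 0 &
    `|D|%:~R * gdot G (ratmx x) (ratmx x) = m%:R >].
  have x0 : (const_mx 1 : 'rV[int]_n.+1) != 0.
    by apply/eqP => /rowP/(_ 0); rewrite !mxE.
  have [m Em] := DQ (const_mx 1); exists m; apply/asboolP.
  by exists (const_mx 1).
have D1 : 0 < `|D|%:~R :> rat by rewrite ltr0z normr_gt0.
case: (ex_minnP exm) => m /asboolP[x x0 Em] minm.
have {minm Em} xmin y : y != 0 ->
    gdot G (ratmx x) (ratmx x) <= gdot G (ratmx y) (ratmx y).
  move=> y0; have [k Ek] := DQ y.
  rewrite -(ler_pM2l D1) Em Ek ler_nat; apply: minm; apply/asboolP.
  by exists y.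
(* Smith reduction of the row x gives a basis R whose first vector r has x as a
   multiple, so r is minimal too. *)
have [L uL [R uR [d _ Ex]]] := int_Smith_normal_form x.
pose r := row 0 R.
have {}Ex : x = (L 0 0 * d`_0) *: r.
  rewrite Ex; apply/rowP => j; rewrite !mxE (bigD1 0) //= big1 ?addr0.
    rewrite !mxE big_ord1 !mxE /= mulr1n //.
  move=> i i0; rewrite !mxE big_ord1 !mxE /=.
  by rewrite -[0%N]/(nat_of_ord (@ord0 n)) eq_sym (inj_eq val_inj) (negPf i0) mulr0n mulr0 mul0r.
set k := L 0 0 * d`_0 in Ex.
have k0 : k != 0 by apply: contra_neq x0 => k0; rewrite Ex k0 scale0r.
have r0 : r != 0 by apply: contra_neq x0 => r0; rewrite Ex r0 scaler0.
have rmin y : y != 0 ->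
    gdot G (ratmx r) (ratmx r) <= gdot G (ratmx y) (ratmx y).
  move=> y0; apply: le_trans (xmin _ y0).
  have -> : ratmx x = k%:~R *: ratmx r by rewrite Ex map_mxZ.
  rewrite gdotZl gdotZr mulrA -intrM ler_peMl //.
    by rewrite ltW // pG // ratmx_eq0.
  by rewrite ler1z -gtz0_ge1 -expr2 exprn_even_gt0.
pose RQ := ratmx R; pose G1 : 'M_(1 + n) := RQ *m G *m RQ^T.
have uRQ : RQ \in unitmx.
  by rewrite unitmxE det_map_mx; apply: rmorph_unit; rewrite -unitmxE.
pose a : rat := G1 0 0; pose w := ursubmx G1; pose C := drsubmx G1.
have aE : a = gdot G (ratmx r) (ratmx r).
  by rewrite /a gram_entry /r map_row.
have a0 : 0 < a by rewrite aE pG // ratmx_eq0.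
have sG1 : G1^T = G1 by rewrite !trmx_mul trmxK sG mulmxA.
have G1E : G1 = block_mx a%:M w w^T C.
  rewrite -{1}[G1]submxK; congr block_mx.
    rewrite /a; move: (G1) => M; apply/matrixP => i j.
    rewrite !ord1 !mxE eqxx mulr1n; congr (M _ _); exact: val_inj.
  by rewrite /w trmx_ursub sG1.
have dG1 : \det G1 = \det G.
  rewrite !det_mulmx det_tr mulrAC -expr2 det_map_mx.
  suff -> : (\det R)%:~R ^+ 2 = 1 :> rat by rewrite mul1r.
  move: uR; rewrite unitmxE => /orP[] /eqP -> //.
pose G' := C - a^-1 *: (w^T *m w).
have sC : C^T = C by rewrite /C trmx_drsub sG1.
have schur t (y : 'rV_n) := gdot_schur w C t y (lt0r_neq0 a0).
have IH : (3%:R / 4%:R * a) ^+ n * (3%:R / 4%:R) ^+ 'C(n, 2) <= \det G'.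
  apply: IHn; [split| |].
  - by rewrite linearB linearZ /= trmx_mul trmxK sC.
  - move=> y y0; pose t := - ((w *m y^T) 0 0 / a).
    have := schur t y; rewrite addNr expr0n mulr0 add0r => <-.
    rewrite -G1E gdot_mulmx pG //.
    apply: contra_neq y0 => /(canRL (mulmxK uRQ)); rewrite mul0mx => z0.
    by rewrite -[y](row_mxKr t%:M) z0 linear0.
  - by rewrite mulr_ge0 ?ltW.
  move=> y y0; pose s := (w *m (ratmx y)^T) 0 0 / a.
  (* The nearest integer to -s: the lift of y is chosen closest to orthogonal. *)
  pose t := - Num.floor (s + 2^-1).
  pose X : 'rV_(1 + n) := row_mx t%:M y.
  have XE : ratmx X = row_mx (t%:~R)%:M (ratmx y).
    by rewrite map_row_mx map_scalar_mx.
  have X0 : X *m R != 0.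
    apply: contra_neq y0 => /(canRL (mulmxK uR)); rewrite mul0mx => z0.
    by rewrite -[y](row_mxKr t%:M) -/X z0 linear0.
  have := rmin _ X0; rewrite map_mxM -gdot_mulmx -/G1 G1E XE schur -aE -/s.
  have : (t%:~R + s) ^+ 2 <= 4^-1.
    have /andP[] := floor_itv (s + 2^-1); rewrite -/t /t intrN intrD.
    set f := (Num.floor _)%:~R => h1 h2.
    nra.
  rewrite -/G'; set q := gdot G' _ _; set e := _ ^+ 2 => e4.
  have : a * e <= a * 4^-1 by rewrite ler_pM2l.
  lra.
rewrite -dG1 G1E det_schur ?lt0r_neq0 // -/G'.
apply: (@le_trans _ _ (a * ((3%:R / 4%:R * a) ^+ n * (3%:R / 4%:R) ^+ 'C(n, 2))));
  last by rewrite ler_pM2l.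
rewrite binS bin1 exprD [(_ * a) ^+ n]exprMn.
set q1 := _ ^+ 'C(n, 2); set q2 := (_ / _) ^+ n.
have -> : a * (q2 * a ^+ n * q1) = a ^+ n.+1 * (q1 * q2) by rewrite exprS; ring.
rewrite ler_wpM2r ?mulr_ge0 ?exprn_ge0 //.
have ca : c <= a by rewrite aE cG.
by rewrite lerXn2r ?nnegrE // ltW.
Qed.

(** * Orthogonal complements in a unimodular lattice *)

Notation mx2 := (map_mx (intr : int -> 'F_2)).

Lemma intrF2_eq0 (z : int) : (z%:~R == 0 :> 'F_2) = (2 %| z)%Z.
Proof.
case: z => z; rewrite ?NegzE ?rmorphN ?oppr_eq0 ?dvdzN //.
all: rewrite -(@dvdn_pcharf _ 2) //; exact: pchar_Fp.
Qed.

Definition rect_diag (K : nmodType) k m (e : nat -> K) : 'M[K]_(k, m) :=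
  \matrix_(i, j) (e i *+ (i == j :> nat)).

Lemma rect_diagS (K : nmodType) k (e : nat -> K) :
  rect_diag (1 + k) (1 + k) e =
  block_mx (const_mx (e 0%N)) 0 0 (rect_diag k k (e \o S)) :> 'M_(1 + k).
Proof.
apply/matrixP => i j; rewrite mxE.
case: (@splitP 1 k i) => i' ii; case: (@splitP 1 k j) => j' jj.
- have -> : i = lshift k i' by exact: val_inj.
  have -> : j = lshift k j' by exact: val_inj.
  by rewrite block_mxEul mxE !ord1.
- have -> : i = lshift k i' by exact: val_inj.
  have -> : j = rshift 1 j' by exact: val_inj.
  by rewrite block_mxEur mxE !ord1.
- have -> : i = rshift 1 i' by exact: val_inj.
  have -> : j = lshift k j' by exact: val_inj.
  by rewrite block_mxEdl mxE !ord1.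
have -> : i = rshift 1 i' by exact: val_inj.
have -> : j = rshift 1 j' by exact: val_inj.
by rewrite block_mxEdr mxE.
Qed.

(** Each even diagonal entry contributes a factor of at least 2 to the
    determinant, and the odd ones are counted by the rank modulo 2. *)
Lemma det_rect_diag_ge k (e : nat -> int) : \det (rect_diag k k e) != 0 ->
  (2 ^ k <= `|\det (rect_diag k k e)| * 2 ^ \rank (mx2 (rect_diag k k e)))%N.
Proof.
elim: k e => [|k IHk] e; first by rewrite det_mx00 /= expn0 mul1n expn_gt0.
rewrite -[k.+1]/(1 + k)%N rect_diagS det_ublock mulf_eq0 => /norP[]; rewrite det_mx11 mxE => e0 /IHk.
rewrite map_block_mx !map_mx0 rank_diag_block_mx abszM.
set M := rect_diag k k _; set E := map_mx _ (const_mx _) => hk.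
have E1 : (2 <= `|e 0%N| * 2 ^ \rank E)%N.
  have [d0|d0] := boolP (2 %| e 0%N)%Z.
    apply: leq_trans (leq_pmulr _ _); last by rewrite expn_gt0.
    by rewrite dvdn_leq // absz_gt0.
  have -> : \rank E = 1%N.
    apply/eqP; rewrite eqn_leq rank_leq_row lt0n mxrank_eq0.
    by apply/eqP => /matrixP/(_ 0 0) /eqP; rewrite !mxE intrF2_eq0 (negPf d0).
  by rewrite expn1 leq_pmull // absz_gt0.
rewrite add1n expnS expnD mulnACA; exact: leq_mul.
Qed.

(** The rows of [V] are pairwise orthogonal roots and those of [N] a basis of
    their orthogonal complement. Smith reduction [U D W] of [G V^T] exhibits the
    complement as the span of the last rows of [U^-1]; [d] is the product of the
    invariant factors, that is, the index of the span of the roots in its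
    saturation. The determinant of the complement is read off a complementary
    minor of the inverse Gram matrix. *)
Lemma orthogonal_lattice k m (G : 'M[int]_(k + m)) (V : 'M[int]_(k, k + m)) :
    G \in unitmx -> V *m G *m V^T = 2%:M ->
  exists (N : 'M[int]_(m, k + m)) (d : int),
    [/\ N *m G *m V^T = 0,
        exists P, N *m P = 1%:M,
        (`|\det (N *m G *m N^T)| * `|d| ^ 2 = 2 ^ k)%N
      & (2 ^ k <= `|d| * 2 ^ \rank (mx2 V))%N].
Proof.
move=> uG VGV.
have [U uU [W uW [e _ E]]] := int_Smith_normal_form (G *m V^T).
pose B := invmx U; have uB : B \in unitmx by rewrite unitmx_inv.
set D := (X in U *m X *m W) in E.
have BE : B *m G *m V^T = D *m W by rewrite -mulmxA E -mulmxA mulKmx.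
have DE : D = col_mx (rect_diag k k (nth 0 e)) 0.
  apply/matrixP => i j; rewrite !mxE.
  case: splitP => i' ii; rewrite mxE ii //.
  by case: eqP (ltn_ord j) => // <-; rewrite ltnNge leq_addr.
set Dk := rect_diag k k _ in DE.
pose N : 'M_(m, k + m) := dsubmx B.
have NV : N *m G *m V^T = 0.
  have : dsubmx (B *m G *m V^T) = 0.
    by rewrite BE DE mul_col_mx mul0mx col_mxKd.
  by rewrite -[X in dsubmx (X *m _ *m _)]vsubmxK !mul_col_mx col_mxKd.
pose G1 := B *m G *m B^T.
have uG1 : G1 \in unitmx by rewrite !unitmx_mul uB uG unitmx_tr.
pose X := invmx G1.
have V1E : (V *m U)^T = X *m D *m W.
  have : G1 *m (V *m U)^T = D *m W.
    by rewrite trmx_mul -BE -!mulmxA;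
      congr (_ *m (_ *m _)); rewrite mulmxA -trmx_mul mulmxV // trmx1 mul1mx.
  by move=> /(canRL (mulKmx uG1)) ->; rewrite mulmxA.
have two : 2%:M = W^T *m (Dk^T *m ulsubmx X^T *m Dk) *m W.
  rewrite -VGV.
  have -> : V *m G *m V^T = (V *m U) *m G1 *m (V *m U)^T.
    rewrite trmx_mul /G1 -!mulmxA; congr (_ *m _).
    rewrite !mulmxA mulmxV // mul1mx -!mulmxA; congr (_ *m _).
    by rewrite mulmxA -trmx_mul mulmxV // trmx1 mul1mx.
  rewrite -[V *m U]trmxK V1E trmxK.
  rewrite !trmx_mul -[_ *m G1 *m _]mulmxA [G1 *m _]mulmxA [G1 *m _]mulmxA mulmxV // mul1mx.
  rewrite DE tr_col_mx trmx0 -{1}[X^T]submxK.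
  rewrite -!mulmxA; congr (_ *m _); rewrite !mulmxA mul_row_block mul_row_col.
  by rewrite !mul0mx !mulmx0 !addr0.
have dW : (`|\det W| = 1)%N.
  by move: uW; rewrite unitmxE => /orP[] /eqP ->.
have d2 : (`|\det Dk| ^ 2 * `|\det (ulsubmx X)| = 2 ^ k)%N.
  have := congr1 (fun M => `|\det M|)%N two.
  rewrite det_scalar !det_mulmx !abszM !det_tr dW mul1n muln1 abszX /= => ->.
  rewrite -trmx_ulsub det_tr mulnAC mulnn //.
(* By Jacobi's identity the Gram determinant of N is the complementary minor of
   the inverse of G1. *)
exists N, (\det Dk); split => //.
- exists (rsubmx U); have := mulVmx uU; rewrite -/B -[B]vsubmxK -[X in _ *m X]hsubmxK.
  by rewrite mul_col_row scalar_mx_block => /eq_block_mx[].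
- rewrite -d2 mulnC; congr (_ * _)%N.
  have -> : N *m G *m N^T = drsubmx G1.
    rewrite /G1 -[B]vsubmxK tr_col_mx mul_col_mx mul_col_row block_mxKdr.
    by rewrite /N.
  have : G1 *m block_mx (ulsubmx X) 0 (dlsubmx X) 1%:M =
         block_mx 1%:M (ursubmx G1) 0 (drsubmx G1).
    have := mulmxV uG1; rewrite -/X -{1}[G1]submxK -{1}[X]submxK mulmx_block.
    rewrite -[1%:M]submxK => /eq_block_mx[e1 _ e2 _].
    rewrite -{1}[G1]submxK mulmx_block !mulmx0 !mulmx1 !add0r e1 e2.
    by rewrite scalar_mx_block block_mxKul block_mxKdl.
  move=> /(congr1 (fun M => `|\det M|)%N).
  rewrite det_mulmx det_lblock det_ublock !det1 mulr1 mul1r abszM => <-.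
  suff -> : (`|\det G1| = 1)%N by rewrite mul1n.
  by move: uG1; rewrite unitmxE => /orP[] /eqP ->.
have Dk0 : \det Dk != 0.
  rewrite -absz_eq0; apply/eqP => d0; move: d2; rewrite d0 exp0n // mul0n.
  by move=> /esym/eqP; rewrite expn_eq0.
apply: leq_trans (det_rect_diag_ge Dk0) _.
have u2 n (M : 'M[int]_n) : M \in unitmx -> mx2 M \in unitmx.
  by rewrite !unitmxE det_map_mx; exact: rmorph_unit.
suff -> : \rank (mx2 Dk) = \rank (mx2 V) by [].
have -> : \rank (mx2 Dk) = \rank (mx2 D).
  by rewrite DE map_col_mx map_mx0 rank_col_mx0.
have DUW : D = B *m (G *m V^T) *m invmx W.
  by rewrite mulmxA BE mulmxK.
rewrite DUW !map_mxM mxrankMfree ?row_free_unit ?u2 ?unitmx_inv //.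
rewrite !(eqmxMfull _ _) ?row_full_unit ?u2 //.
by rewrite -map_trmx mxrank_tr.
Qed.

(** * Orthogonal roots in an even unimodular lattice of rank 8 *)

Definition even_form n (G : 'M[int]_n) := forall x, (2 %| gdot G x x)%Z.

Lemma ratmx_gdot n (G : 'M[int]_n) (x y : 'rV[int]_n) :
  (gdot G x y)%:~R = gdot (ratmx G) (ratmx x) (ratmx y).
Proof. by rewrite /gdot map_trmx -!map_mxM [RHS]mxE. Qed.

Lemma posdef_ratP n (G : 'M[int]_n) (x : 'rV[int]_n) :
  posdef (ratmx G) -> x != 0 -> 0 < gdot G x x.
Proof. by move=> [_ pG] x0; rewrite -(ltr0z rat) ratmx_gdot pG // ratmx_eq0. Qed.

Lemma posdef_sym n (G : 'M[int]_n) : posdef (ratmx G) -> G^T = G.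
Proof.
move=> [sG _]; apply/matrixP => i j; move/matrixP/(_ i j): sG.
by rewrite !mxE => /intr_inj.
Qed.

(** Modulo 2 the roots are orthogonal to each other and to themselves, so they
    span a totally isotropic subspace of a nondegenerate space. *)
Lemma roots_rank_mod2 k n (G : 'M[int]_n) (V : 'M[int]_(k, n)) :
  G \in unitmx -> V *m G *m V^T = 2%:M -> ((\rank (mx2 V)).*2 <= n)%N.
Proof.
move=> uG /(congr1 mx2); rewrite !map_mxM => VGV.
have : mx2 V *m (mx2 G *m mx2 V^T) = 0.
  rewrite mulmxA VGV map_scalar_mx /=.
  by have /eqP-> : (2%:~R == 0 :> 'F_2) by []; rewrite raddf0.
move=> /mulmx0_rank_max; rewrite eqmxMfull; last first.
  by rewrite row_full_unit unitmxE det_map_mx rmorph_unit // -unitmxE.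
by rewrite -map_trmx mxrank_tr addnn.
Qed.

(** The comparison that makes Hermite's inequality yield a root: here [a] is the
    determinant of the complement of [k] orthogonal roots and [e] the index of
    their span in its saturation; even vectors other than roots have norm at
    least 4. *)
Lemma hermite_bound k a e : (k < 8)%N ->
    (2 ^ k <= e * 16)%N -> (a * e ^ 2 = 2 ^ k)%N ->
  a%:R < 4%:R ^+ (8 - k) * (3%:R / 4%:R) ^+ 'C(8 - k, 2) :> rat.
Proof.
move=> k8 d2 dN.
have ae : (a * 4 ^ (k - 4) <= 2 ^ k)%N.
  have e1 : (2 ^ (k - 4) <= e)%N.
    have [k4|k4] := leqP k 4.
      rewrite (eqP k4) expn0 lt0n; apply/eqP => e0; move: dN.
      by rewrite e0 muln0 => /esym/eqP; rewrite expn_eq0.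
    by move: d2; rewrite -(subnK (ltnW k4)) addnK expnD leq_pmul2r.
  rewrite -dN leq_mul2l (_ : 4 = 2 ^ 2)%N // -expnM mulnC expnM leq_exp2r // e1 orbT.
  by [].
move: ae; rewrite -(ler_nat rat) natrM.
(* The numbers below are 8 - k, then 'C(8 - k, 2), then k - 4. *)
clear d2 dN; rewrite bin2; move: k8.
have num m c l : (8 - k)%N = m -> (m * m.-1)./2 = c -> (k - 4)%N = l ->
    (a%:R * 4%:R ^+ l <= 2%:R ^+ k :> rat ->
     a%:R < 4%:R ^+ m * (3%:R / 4%:R) ^+ c :> rat) ->
  a%:R * (4 ^ (k - 4))%:R <= (2 ^ k)%:R :> rat ->
  a%:R < 4%:R ^+ (8 - k) * (3%:R / 4%:R) ^+ ((8 - k) * (8 - k).-1)./2 :> rat.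
  by move=> -> -> ->; rewrite !natrX.
case: k => [|k] in num *.
  by move=> _; apply: (num 8%N 28%N 0%N erefl erefl erefl); lra.
case: k => [|k] in num *.
  by move=> _; apply: (num 7%N 21%N 0%N erefl erefl erefl); lra.
case: k => [|k] in num *.
  by move=> _; apply: (num 6%N 15%N 0%N erefl erefl erefl); lra.
case: k => [|k] in num *.
  by move=> _; apply: (num 5%N 10%N 0%N erefl erefl erefl); lra.
case: k => [|k] in num *.
  by move=> _; apply: (num 4%N 6%N 0%N erefl erefl erefl); lra.
case: k => [|k] in num *.
  by move=> _; apply: (num 3%N 3%N 1%N erefl erefl erefl); lra.
case: k => [|k] in num *.
  by move=> _; apply: (num 2%N 1%N 2%N erefl erefl erefl); lra.
case: k => [|k] in num *.
  by move=> _; apply: (num 1%N 0%N 3%N erefl erefl erefl); lra.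
by [].
Qed.

(** Otherwise every nonzero vector of the complement has norm at least 4, and
    Hermite's inequality makes the determinant of the complement too large. *)
Lemma orthogonal_root k m (G : 'M[int]_(k + m)) (V : 'M[int]_(k, k + m)) :
    (k + m = 8)%N -> (k < 8)%N ->
    G \in unitmx -> posdef (ratmx G) -> even_form G -> V *m G *m V^T = 2%:M ->
  exists r, gdot G r r = 2 /\ r *m G *m V^T = 0.
Proof.
move=> km k8 uG pG eG VGV.
have [N [d [NV [P NP] dN d2]]] := orthogonal_lattice uG VGV.
have [//|noroot] := pselect (exists r, gdot G r r = 2 /\ r *m G *m V^T = 0).
pose GN := N *m G *m N^T.
have ratGN (x : 'rV_m) : gdot (ratmx GN) (ratmx x) (ratmx x) =
    (gdot G (x *m N) (x *m N))%:~R by rewrite -ratmx_gdot gdot_mulmx.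
have uGN : posdef (ratmx GN).
  split=> [|x x0]; first by rewrite map_trmx !trmx_mul trmxK mulmxA (posdef_sym pG).
  rewrite !map_mxM -map_trmx gdot_mulmx pG.2 //.
  apply: contra_neq x0 => /(congr1 (mulmx^~ (ratmx P))).
  by rewrite -mulmxA -map_mxM NP map_mx1 mulmx1 mul0mx.
have rootN (y : 'rV[int]_m) : y != 0 -> 4%:R <= gdot (ratmx GN) (ratmx y) (ratmx y).
  move=> y0; rewrite ratGN -[4%:R]/(4%:~R) ler_int.
  have z0 : y *m N != 0.
    by apply: contra_neq y0 => /(congr1 (mulmx^~ P)); rewrite -mulmxA NP mulmx1 mul0mx.
  have := posdef_ratP pG z0; have := eG (y *m N).
  have : gdot G (y *m N) (y *m N) <> 2.
    move=> r2; case: noroot; exists (y *m N); split => //.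
    by rewrite -!mulmxA [N *m _]mulmxA NV mulmx0.
  lia.
have := hermite_inequality uGN _ rootN; rewrite det_map_mx => /(_ isT).
have {}d2 : (2 ^ k <= `|d| * 16)%N.
  have rk : ((\rank (mx2 V)).*2 <= 8)%N.
    by rewrite -[X in (_ <= X)%N]km; exact: roots_rank_mod2 uG VGV.
  apply: leq_trans d2 _; rewrite leq_mul2l (@leq_exp2l 2 _ 4) //; lia.
have dl : (\det GN)%:~R <= `|\det GN|%:R :> rat.
  by rewrite natr_absz ler_int ler_norm.
move=> /le_trans/(_ dl); move: dN; rewrite -/GN.
move: (`|\det GN|)%N (`|d|)%N d2 => a e d2 dN.
move=> h; have := hermite_bound k8 d2 dN; have <- : m = (8 - k)%N by lia.
by rewrite ltNge h.
Qed.

Lemma eight_roots (G : 'M[int]_8) :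
    G \in unitmx -> posdef (ratmx G) -> even_form G ->
  exists V : 'M[int]_8, V *m G *m V^T = 2%:M.
Proof.
move=> uG pG eG.
suff : forall k, (k <= 8)%N -> exists V : 'M[int]_(k, 8), V *m G *m V^T = 2%:M.
  by apply.
elim=> [|k IHk] k8; first by exists 0; apply/matrixP => -[].
have [V VGV] := IHk (ltnW k8).
have [r [rr rV]] : exists r, gdot G r r = 2 /\ r *m G *m V^T = 0.
  have gen m n (H : 'M[int]_n) (X : 'M_(k, n)) : (k + m)%N = n -> n = 8%N ->
      H \in unitmx -> posdef (ratmx H) -> even_form H -> X *m H *m X^T = 2%:M ->
      exists r, gdot H r r = 2 /\ r *m H *m X^T = 0.
    by move=> kmn; subst n => km; apply: orthogonal_root.
  exact: (gen _ _ _ _ (subnKC (ltnW k8))).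
rewrite -[k.+1]/(1 + k)%N; exists (col_mx r V).
rewrite tr_col_mx mul_col_mx mul_col_row rV VGV.
have -> : V *m G *m r^T = 0.
  by apply: trmx_inj; rewrite trmx0 !trmx_mul trmxK (posdef_sym pG) mulmxA.
rewrite [RHS]scalar_mx_block; congr block_mx.
by apply/matrixP => i j; rewrite !ord1 [LHS]rr mxE.
Qed.

(** * The code of half-sums of eight orthogonal roots *)

Section Frame.
Variable G : 'M[int]_8.
Hypotheses (uG : G \in unitmx) (pG : posdef (ratmx G)) (eG : even_form G).
Implicit Types (a : nat -> 'rV[int]_8) (s t p : seq nat).

Definition frame a := forall i j, (i < 8)%N -> (j < 8)%N ->
  gdot G (a i) (a j) = 2 *+ (i == j).

(** The index list [s] is a word of the code: the sum of its roots is twice a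
    lattice vector. *)
Definition half_sum a s := exists h, \sum_(i <- s) a i = 2 *: h.

Definition index_seq s := uniq s && all (fun i => i < 8)%N s.

Lemma half_perm a s t : perm_eq s t -> half_sum a s -> half_sum a t.
Proof. by move=> st [h hh]; exists h; rewrite -hh; apply: perm_big; rewrite perm_sym. Qed.

Lemma half_comp a p s : half_sum a (map (nth 0%N p) s) -> half_sum (a \o nth 0%N p) s.
Proof. by move=> [h]; rewrite big_map => hh; exists h. Qed.

Lemma frame_comp a p : frame a -> perm_eq p (iota 0 8) -> frame (a \o nth 0%N p).
Proof.
move=> fa pp i j i8 j8.
have sp : size p = 8%N by rewrite (perm_size pp).
have p8 k : (k < 8)%N -> (nth 0%N p k < 8)%N.
  move=> k8; suff: nth 0%N p k \in iota 0 8 by rewrite mem_iota => /andP[].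
  by rewrite -(perm_mem pp) mem_nth ?sp.
rewrite /= fa ?p8 // nth_uniq ?sp // (perm_uniq pp) iota_uniq //.
Qed.

Lemma frame_sum a s t : frame a -> index_seq s -> index_seq t ->
  gdot G (\sum_(i <- s) a i) (\sum_(j <- t) a j) = 2 *+ count [in t] s.
Proof.
move=> fa /andP[us /allP s8] /andP[ut /allP t8].
have E (x : 'rV_8) : gdot G (\sum_(i <- s) a i) x = \sum_(i <- s) gdot G (a i) x.
  by apply: (big_morph (fun y => gdot G y x)) => [y z|]; rewrite ?gdotDl // /gdot !mul0mx mxE.
rewrite E.
have F i : i \in s -> gdot G (a i) (\sum_(j <- t) a j) = 2 *+ (i \in t).
  move=> /s8 i8.
  have -> : gdot G (a i) (\sum_(j <- t) a j) = \sum_(j <- t) gdot G (a i) (a j).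
    by apply: (big_morph (gdot G (a i))) => [y z|]; rewrite ?gdotDr // /gdot trmx0 mulmx0 mxE.
  have -> : \sum_(j <- t) gdot G (a i) (a j) = \sum_(j <- t) (2 *+ (j == i)).
    by apply: eq_big_seq => j /t8 j8; rewrite fa // eq_sym.
  by rewrite sumrMnr -big_mkcond /= sum1_count count_uniq_mem.
rewrite (eq_big_seq _ F) sumrMnr; congr (_ *+ _).
by rewrite -big_mkcond /= sum1_count.
Qed.

(** The inner product of two half-sums is half the number of common roots. *)
Lemma half_parity a s t : frame a -> index_seq s -> index_seq t -> half_sum a s -> half_sum a t ->
  ~~ odd (count [in t] s).
Proof.
move=> fa gs gt [h hs] [k kt]; have := frame_sum fa gs gt.
rewrite hs kt gdotZl gdotZr mulrA => E.
suff : (2 %| count [in t] s)%N by rewrite dvdn2.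
move: E; set c := count _ _; set q := gdot _ _ _ => E.
have : (c%:Z = q * 2)%R by move: E; rewrite -mulr_natr natz; lia.
lia.
Qed.

(** A half-sum of [n] roots has norm [n / 2], an even integer. *)
Lemma half_size a s : frame a -> index_seq s -> half_sum a s -> (4 %| size s)%N.
Proof.
move=> fa gs [h hs]; have := frame_sum fa gs gs; rewrite hs gdotZl gdotZr mulrA.
have -> : count [in s] s = size s by apply/eqP; rewrite -all_count; apply/allP.
have /dvdzP[q ->] := eG h; rewrite -mulr_natr natz => E.
have : ((size s)%:Z = q * 4)%R by lia.
lia.
Qed.

(** Five roots are linearly dependent modulo 2, as they span a subspace of
    dimension at most 4. A dependency is a word of the code, of weight divisible
    by 4, so it omits exactly one of the five roots. *)
Lemma five_roots_dependent a s : frame a -> index_seq s -> size s = 5%N ->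
  exists2 i, i \in s & half_sum a (rem i s).
Proof.
move=> fa gs s5; have /andP[us /allP s8] := gs.
pose V : 'M[int]_(5, 8) := \matrix_i a (nth 0%N s i).
have VGV : V *m G *m V^T = 2%:M.
  apply/matrixP => i j; rewrite gram_entry !rowK mxE fa ?s8 ?mem_nth ?s5 //.
  by rewrite nth_uniq ?s5.
have rk := roots_rank_mod2 uG VGV.
have : kermx (mx2 V) != 0.
  rewrite -mxrank_eq0 mxrank_ker subn_eq0 -ltnNge; lia.
move=> /rowV0Pn[u /sub_kermxP uV u0].
pose t := [seq i <- s | u 0 (inord (index i s)) != 0].
have st : subseq t s by exact: filter_subseq.
have gt : index_seq t.
  rewrite /index_seq (subseq_uniq st) //=; apply/allP => i it; apply: s8; exact: (mem_subseq st).
have ut (i : 'I_5) : u 0 i = (nth 0%N s i \in t)%:R.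
  rewrite mem_filter index_uniq ?s5 // inord_val mem_nth ?s5 // andbT.
  by case: (u 0 i) => -[|[|//]] h; rewrite -?val_eqE /=; apply: val_inj.
have ht : half_sum a t.
  have E : \sum_(i <- t) a i = \sum_(i < 5) a (nth 0%N s i) *+ (nth 0%N s i \in t).
    rewrite [LHS](_ : _ = \sum_(i <- s | i \in t) a i).
      by rewrite big_mkcond (big_nth 0) s5 big_mkord; apply: eq_bigr => i _; case: (_ \in _).
    rewrite -[RHS]big_filter; have -> // : [seq i <- s | i \in t] = t.
    by rewrite {2}/t; apply: eq_in_filter => i si; rewrite mem_filter si andbT.
  have even j : (2 %| ((\sum_(i <- t) a i) ord0 j)%R)%Z.
    rewrite -intrF2_eq0; move/matrixP/(_ 0 j): uV; rewrite !mxE E => uVj.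
    apply/eqP; rewrite -[RHS]uVj summxE rmorph_sum /=; apply: eq_bigr => i _; rewrite !mxE ut.
    by case: (_ \in t); rewrite ?mul1r ?mul0r // mulr0n mxE.
  exists (\row_j (((\sum_(i <- t) a i) ord0 j)%R %/ 2)%Z); apply/rowP => j.
  by rewrite !mxE mulrC divzK.
have t4 := half_size fa gt ht.
have t0 : (0 < size t)%N.
  rewrite lt0n size_eq0; apply: contra_neq u0 => t0.
  by apply/rowP => i; rewrite ut t0 mxE.
have t5 : (size t <= 5)%N by rewrite -s5 size_subseq.
have {t4 t0 t5} t4 : size t = 4%N.
  case/dvdnP: t4 => q qE; move: t0 t5; rewrite qE.
  by case: q {qE} => [|[|q]] //; lia.
have [i si nit] : exists2 i, i \in s & i \notin t.
  apply/hasP/negPn/negP; rewrite -all_predC => /allP ts.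
  suff : (size s <= size t)%N by rewrite s5 t4.
  by apply: uniq_leq_size => // i /ts /=; rewrite negbK.
exists i => //; apply: half_perm ht.
have /andP[utt _] := gt.
rewrite uniq_perm ?rem_uniq //.
have sub : {subset t <= rem i s}.
  move=> j jt; rewrite mem_rem_uniq // inE (mem_subseq st) // andbT.
  by apply: contraNneq nit => <-.
by have [] := uniq_min_size utt sub; rewrite // size_rem // s5 t4.
Qed.

(** Each of the four words comes from a well-chosen set of five roots. The other
    words this set may carry are equivalent up to renumbering, or meet a word
    already found in an odd number of places. *)
Lemma hamming_frame : exists a, [/\ frame a, half_sum a [:: 0; 1; 2; 3]%N,
  half_sum a [:: 0; 1; 4; 5]%N, half_sum a [:: 0; 1; 6; 7]%N
  & half_sum a [:: 0; 2; 4; 6]%N].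
Proof.
have [a fa] : exists a, frame a.
  have [V VGV] := eight_roots uG pG eG.
  exists (fun i => row (inord i) V) => i j i8 j8.
  by rewrite -gram_entry VGV mxE -val_eqE /= !inordK.
have {a fa} [a [fa h1]] : exists a, frame a /\ half_sum a [:: 0; 1; 2; 3]%N.
  have [i] := five_roots_dependent fa (s := iota 0 5) isT erefl.
  have rl p t : perm_eq p (iota 0 8) -> half_sum a t ->
      perm_eq t (map (nth 0%N p) [:: 0; 1; 2; 3]%N) ->
      exists a, frame a /\ half_sum a [:: 0; 1; 2; 3]%N.
    move=> pp ht tp; exists (a \o nth 0%N p); split; first exact: frame_comp.
    exact/half_comp/(half_perm tp).
  rewrite !inE => /or4P[/eqP->|/eqP->|/eqP->|/orP[]/eqP->] /= h.
  - by apply: (rl [:: 1; 2; 3; 4; 0; 5; 6; 7]%N) h _.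
  - by apply: (rl [:: 0; 2; 3; 4; 1; 5; 6; 7]%N) h _.
  - by apply: (rl [:: 0; 1; 3; 4; 2; 5; 6; 7]%N) h _.
  - by apply: (rl [:: 0; 1; 2; 4; 3; 5; 6; 7]%N) h _.
  - by apply: (rl [:: 0; 1; 2; 3; 4; 5; 6; 7]%N) h _.
have {a fa h1} [a [fa h1 h2]] : exists a, [/\ frame a, half_sum a [:: 0; 1; 2; 3]%N &
   half_sum a [:: 0; 1; 4; 5]%N].
  have [i] := five_roots_dependent fa (s := [:: 0; 1; 2; 4; 5]%N) isT erefl.
  have rl p t : perm_eq p (iota 0 8) -> half_sum a t ->
      perm_eq [:: 0; 1; 2; 3]%N (map (nth 0%N p) [:: 0; 1; 2; 3]%N) ->
      perm_eq t (map (nth 0%N p) [:: 0; 1; 4; 5]%N) ->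
      exists a, [/\ frame a, half_sum a [:: 0; 1; 2; 3]%N & half_sum a [:: 0; 1; 4; 5]%N].
    move=> pp ht p1 tp; exists (a \o nth 0%N p); split; first exact: frame_comp.
      exact/half_comp/(half_perm p1).
    exact/half_comp/(half_perm tp).
  rewrite !inE => /or4P[/eqP->|/eqP->|/eqP->|/orP[]/eqP->] /= h.
  - by apply: (rl [:: 1; 2; 0; 3; 4; 5; 6; 7]%N) h _ _.
  - by apply: (rl [:: 0; 2; 1; 3; 4; 5; 6; 7]%N) h _ _.
  - by apply: (rl [:: 0; 1; 2; 3; 4; 5; 6; 7]%N) h _ _.
  - by have := half_parity fa _ _ h1 h => /(_ isT isT).
  - by have := half_parity fa _ _ h1 h => /(_ isT isT).
have h3 : half_sum a [:: 0; 1; 6; 7]%N.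
  have [i] := five_roots_dependent fa (s := [:: 0; 1; 4; 6; 7]%N) isT erefl.
  rewrite !inE => /or4P[/eqP->|/eqP->|/eqP->|/orP[]/eqP->] //= h.
  - by have := half_parity fa _ _ h1 h => /(_ isT isT).
  - by have := half_parity fa _ _ h1 h => /(_ isT isT).
  - by have := half_parity fa _ _ h2 h => /(_ isT isT).
  - by have := half_parity fa _ _ h2 h => /(_ isT isT).
have [i] := five_roots_dependent fa (s := [:: 0; 2; 4; 6; 7]%N) isT erefl.
rewrite !inE => /or4P[/eqP->|/eqP->|/eqP->|/orP[]/eqP->] /= h4.
- by have := half_parity fa _ _ h1 h4 => /(_ isT isT).
- by have := half_parity fa _ _ h1 h4 => /(_ isT isT).
- by have := half_parity fa _ _ h3 h4 => /(_ isT isT).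
- exists (a \o nth 0%N [:: 0; 1; 2; 3; 4; 5; 7; 6]%N).
  split; [exact: frame_comp | exact/half_comp/(half_perm _ h1)
         | exact/half_comp/(half_perm _ h2) | exact/half_comp/(half_perm _ h3)
         | exact/half_comp/(half_perm _ h4)].
by exists a.
Qed.

(** The rows of [F] are twice an orthonormal frame of E8: the sums and
    differences of the pairs of roots 01, 23, 45, 67. The words 0123, 0145, 0167
    make them congruent modulo 2, and the word 0246 makes their sum divisible
    by 4. *)
Lemma norm4_frame : exists F : 'M[int]_8,
  [/\ F *m G *m F^T = 4%:M,
      forall i, exists h, row i F = row 0 F + 2 *: h
    & exists h, \sum_i row i F = 4 *: h].
Proof.
have [a [fa [h1 e1] [h2 e2] [h3 e3] [h4 e4]]] := hamming_frame.
pose f := nth 0 [:: a 0%N + a 1%N; a 0%N - a 1%N; a 2%N + a 3%N; a 2%N - a 3%N;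
  a 4%N + a 5%N; a 4%N - a 5%N; a 6%N + a 7%N; a 6%N - a 7%N].
exists (\matrix_i f i); split.
- have opp x y : gdot G x (- y) = - gdot G x y by rewrite -scaleN1r gdotZr mulN1r.
  have oppl x y : gdot G (- x) y = - gdot G x y by rewrite -scaleN1r gdotZl mulN1r.
  apply/matrixP => i j; rewrite gram_entry !rowK mxE.
  case: i => -[|[|[|[|[|[|[|[|//]]]]]]]] li; case: j => -[|[|[|[|[|[|[|[|//]]]]]]]] lj;
  by rewrite /f /= !(gdotDl, gdotDr, opp, oppl) !fa.
- move=> i; rewrite !rowK.
  move: e1 e2 e3; rewrite !big_cons !big_nil !addr0 => e1 e2 e3.
  case: i => -[|[|[|[|[|[|[|[|//]]]]]]]] li; rewrite /f /=.
  + by exists 0; rewrite scaler0 addr0.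
  + by exists (- a 1%N); apply/rowP => k; rewrite !mxE; ring.
  + exists (h1 - a 0%N - a 1%N); apply/rowP => k.
    by move/rowP/(_ k): e1; rewrite !mxE => ?; lra.
  + exists (h1 - a 0%N - a 1%N - a 3%N); apply/rowP => k.
    by move/rowP/(_ k): e1; rewrite !mxE => ?; lra.
  + exists (h2 - a 0%N - a 1%N); apply/rowP => k.
    by move/rowP/(_ k): e2; rewrite !mxE => ?; lra.
  + exists (h2 - a 0%N - a 1%N - a 5%N); apply/rowP => k.
    by move/rowP/(_ k): e2; rewrite !mxE => ?; lra.
  + exists (h3 - a 0%N - a 1%N); apply/rowP => k.
    by move/rowP/(_ k): e3; rewrite !mxE => ?; lra.
  + exists (h3 - a 0%N - a 1%N - a 7%N); apply/rowP => k.
    by move/rowP/(_ k): e3; rewrite !mxE => ?; lra.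
exists h4; move: e4; rewrite !big_cons !big_nil !addr0 => /rowP e4.
apply/rowP => k; move: (e4 k); rewrite !big_ord_recl big_ord0 !rowK /f /= !mxE => ?; lra.
Qed.

End Frame.

(** * The E8 coordinates *)

Lemma ratmx_inj m n : injective (map_mx (intr : int -> rat) : 'M_(m, n) -> _).
Proof.
move=> A B /matrixP AB; apply/matrixP => i j.
by move: (AB i j); rewrite !mxE => /intr_inj.
Qed.

(** The coordinates of [x] in the orthonormal frame [F / 2] are the
    [gdot G x (row i F) / 2]. They are all integers or all half-integers because
    the rows of [F] are congruent modulo 2, and their half-sum is an integer
    because the sum of the rows is divisible by 4. Conversely, the same two
    congruences put every vector of D8+ in the lattice. *)
Lemma even_unimodular8_E8 (R : realType) (G : 'M[int]_8) :
    G \in unitmx -> posdef (ratmx G) -> even_form G ->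
  exists phi : 'rV[int]_8 -> 'rV[R]_8,
    [/\ {morph phi : x y / x + y},
        forall x y, dot (phi x) (phi y) = (gdot G x y)%:~R,
        forall x, E8 (phi x)
      & forall v, E8 v -> exists x, phi x = v].
Proof.
move=> uG pG eG; have [F [FGF Fi [h hF]]] := norm4_frame uG pG eG.
have gff i j : gdot G (row i F) (row j F) = 4 *+ (i == j).
  by rewrite -gram_entry FGF mxE.
have GFFG : G *m F^T *m F *m G = 4 *: G.
  apply: ratmx_inj; rewrite map_mxZ !map_mxM.
  set g := ratmx G; set f := ratmx F; set f' := ratmx F^T.
  have : f *m (4%:R^-1 *: (g *m f')) = 1%:M.
    rewrite -scalemxAr mulmxA -!map_mxM FGF map_scalar_mx.
    by rewrite scale_scalar_mx mulVf.
  move=> /mulmx1C; rewrite -scalemxAl => /(canRL (scalerKV _)) -> //.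
  by rewrite -scalemxAl mul1mx.
pose phi (x : 'rV[int]_8) : 'rV[R]_8 := \row_i ((gdot G x (row i F))%:~R / 2%:R).
have phi2 (x y : 'rV[int]_8) (j : 'I_8) :
    x = 2 *: y -> phi y ord0 j = (gdot G x (row j F))%:~R / 4%:R.
  by move=> ->; rewrite mxE gdotZl intrM; field.
have sumF : forall (z : 'I_8 -> int) j,
    gdot G (\sum_i z i *: row i F) (row j F) = 4 * z j.
  move=> z j; have -> : gdot G (\sum_i z i *: row i F) (row j F) =
      \sum_i gdot G (z i *: row i F) (row j F).
    by apply: (big_morph (fun y => gdot G y _)) => [y t|]; rewrite ?gdotDl // /gdot !mul0mx mxE.
  rewrite (bigD1 j) //= big1 => [|i ij]; rewrite gdotZl gff ?eqxx ?(negPf ij) /= ?mulr0 //.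
  by rewrite addr0 mulr1n mulrC.
have phisum (z : 'I_8 -> int) (w : int) : \sum_i z i = 2 * w ->
    exists y, forall j, phi y 0 j = (z j)%:~R.
  have /(@choice _ _ _)[k Fk] := Fi.
  move=> zw; exists (w *: row 0 F + \sum_i z i *: k i) => j.
  have := sumF z j.
  rewrite (phi2 (\sum_i z i *: row i F)) => [->|]; first by rewrite intrM; field.
  rewrite scalerDr scalerA -zw scaler_suml scaler_sumr -big_split /=.
  by apply: eq_bigr => i _; rewrite [in LHS]Fk scalerDr !scalerA mulrC.
exists phi; split.
- by move=> x y; apply/rowP => i; rewrite !mxE gdotDl intrD mulrDl.
- move=> x y; rewrite /dot mxE.
  apply: (@mulfI _ 4%:R); first by rewrite pnatr_eq0.
  have E : \sum_i gdot G x (row i F) * gdot G y (row i F) = 4 * gdot G x y.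
    have <- : gdot (4 *: G) x y = 4 * gdot G x y.
      by rewrite /gdot -scalemxAr -scalemxAl mxE.
    have -> : gdot (4 *: G) x y = ((x *m G *m F^T) *m (F *m G *m y^T)) 0 0.
      by rewrite -GFFG /gdot !mulmxA.
    rewrite mxE; apply: eq_bigr => i _.
    congr (_ * _); first by rewrite /gdot !mxE; apply: eq_bigr => k _; rewrite !mxE.
    by rewrite gdotC ?(posdef_sym pG) // /gdot -!row_mul mxE.
  rewrite -[4%:R]/(4%:~R) -intrM -E rmorph_sum mulr_sumr /=.
  by apply: eq_bigr => i _; rewrite !mxE intrM; field.
- move=> x; pose c (i : 'I_8) : int := gdot G x (row i F).
  have cE i : exists k, c i = c 0 + 2 * k.
    by have [k Ek] := Fi i; exists (gdot G x k); rewrite /c Ek gdotDr gdotZr.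
  split; last first.
    have : \sum_i c i = 4 * gdot G x h.
      rewrite -gdotZr -hF; symmetry.
      by apply: (big_morph (gdot G x)) => [y t|]; rewrite ?gdotDr // /gdot trmx0 mulmx0 mxE.
    move=> /(congr1 (fun z => z%:~R : R)); rewrite rmorph_sum intrM /= => E.
    have -> : (\sum_i phi x 0 i) / 2%:R = (gdot G x h)%:~R.
      rewrite (eq_bigr (fun i => (c i)%:~R / 2%:R)) => [|i _]; last by rewrite mxE.
      by rewrite -mulr_suml E; field.
    exact: intr_int.
  have [d0|d0] := boolP (2 %| c ord0)%Z; [left|right] => i; rewrite mxE -/(c i);
    have [k ->] := cE i.
    case/dvdzP: d0 => q ->.
    have -> : (q * 2 + 2 * k)%:~R / 2%:R = (q + k)%:~R :> R by rewrite !intrD !intrM; field.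
    exact: intr_int.
  have [q ->] : exists q, c 0 = 2 * q + 1 by move: (c 0) d0 => t d0; exists (t %/ 2)%Z; lia.
  have -> : (2 * q + 1 + 2 * k)%:~R / 2%:R - 2^-1 = (q + k)%:~R :> R by rewrite !intrD !intrM; field.
  exact: intr_int.
move=> v [vint /intrP[w vw]].
have Ev : \sum_i v 0 i = (2 * w)%:~R by rewrite intrM -vw; field.
case: vint => vint.
  have /choice[z vz] : forall i, exists z : int, v 0 i = z%:~R by move=> i; apply/intrP.
  have /phisum[y Ey] : \sum_i z i = 2 * w.
    apply: (@intr_inj R); rewrite -Ev rmorph_sum /=; apply: eq_bigr => i _; rewrite vz //.
  by exists y; apply/rowP => j; rewrite Ey vz.
have /choice[z vz] : forall i, exists z : int, v 0 i = z%:~R + 2^-1.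
  by move=> i; have /intrP[z Ez] := vint i; exists z; rewrite -Ez subrK.
have /phisum[y Ey] : \sum_i z i = 2 * (w - 2).
  apply: (@intr_inj R); rewrite mulrBr intrB -Ev rmorph_sum /=.
  rewrite (eq_bigr _ (fun i _ => vz i)) big_split /= sumr_const card_ord -mulr_natr.
  by field.
exists (y + h); apply/rowP => j.
have -> : phi (y + h) 0 j = phi y 0 j + phi h 0 j by rewrite !mxE gdotDl intrD mulrDl.
rewrite Ey vz; congr (_ + _).
have := sumF (fun=> 1) j; rewrite (eq_bigr (fun i => row i F)) => [|i _]; last by rewrite scale1r.
rewrite hF gdotZl => E; rewrite mxE (_ : gdot G h (row j F) = 1); last by lia.
by rewrite mul1r.
Qed.

(** * Lattices in rational vector spaces *)

Lemma intSpan0 (V : zmodType) n (b : n.-tuple V) : inIntSpan b 0.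
Proof. by exists [ffun=> 0]; rewrite big1 // => i _; rewrite ffunE mulr0z. Qed.

Lemma intSpanD (V : zmodType) n (b : n.-tuple V) x y :
  inIntSpan b x -> inIntSpan b y -> inIntSpan b (x + y).
Proof.
move=> [u ->] [v ->]; exists [ffun i => u i + v i]; rewrite -big_split /=.
by apply: eq_bigr => i _; rewrite ffunE mulrzDr.
Qed.

Lemma intSpanN (V : zmodType) n (b : n.-tuple V) x :
  inIntSpan b x -> inIntSpan b (- x).
Proof.
move=> [u ->]; exists [ffun i => - u i]; rewrite -sumrN.
by apply: eq_bigr => i _; rewrite ffunE mulrNz.
Qed.

Lemma intSpan_nth (V : zmodType) n (b : n.-tuple V) (i : 'I_n) :
  inIntSpan b b`_i.
Proof.
exists [ffun j => (j == i)%:R]; rewrite (bigD1 i) //= ffunE eqxx mulr1z.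
by rewrite big1 ?addr0 // => j ji; rewrite ffunE (negPf ji) mulr0z.
Qed.

Lemma addclosed_mulz (V : zmodType) (M : V -> Prop) :
  M 0 -> (forall x y, M x -> M y -> M (x + y)) -> (forall x, M x -> M (- x)) ->
  forall x (z : int), M x -> M (x *~ z).
Proof.
move=> M0 MD MN x z Mx; have Mn k : M (x *+ k) by elim: k => // k ?; rewrite mulrS; exact: MD.
by case: z => k; [exact: Mn | apply: MN; exact: Mn].
Qed.

Lemma addclosed_sum (V : zmodType) (M : V -> Prop) I (r : seq I) (F : I -> V) :
  M 0 -> (forall x y, M x -> M y -> M (x + y)) -> (forall i, M (F i)) ->
  M (\sum_(i <- r) F i).
Proof. by move=> M0 MD MF; apply: big_ind. Qed.

(** Full-rank subgroups of [Z^n] are free: among the bases of full-rank sublattices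
    of [S], one of least determinant in absolute value spans [S]. By Cramer's
    rule the entries of [x *m \adj B] are the determinants of [B] with one row
    replaced by [x]; were one of them not a multiple of [\det B], subtracting a
    multiple of that row from [x] would make the determinant smaller. *)
Lemma subgroup_basis n (S : 'rV[int]_n -> Prop) (N : int) : N != 0 ->
    (forall x y, S x -> S y -> S (x + y)) -> (forall x, S x -> S (- x)) ->
    (forall x, S (N *: x)) ->
  exists B : 'M[int]_n, (forall i, S (row i B)) /\
    forall x, S x -> exists w, x = w *m B.
Proof.
move=> N0 SD SN SNx.
have S0 : S 0 by rewrite -(scaler0 _ N).
have SZ x (z : int) : S x -> S (z *: x).
  by move=> Sx; rewrite -[z]intz scaler_int; exact: addclosed_mulz.
have exd : exists d, `[< exists B : 'M[int]_n,
    [/\ forall i, S (row i B), \det B != 0 & `|\det B|%N = d] >].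
  exists `|\det (N%:M : 'M_n)|%N; apply/asboolP; exists N%:M; split=> // [i|].
    rewrite -scalemx1 linearZ; exact: SNx.
  by rewrite det_scalar expf_neq0.
case: (ex_minnP exd) => d /asboolP[B [SB dB Ed]] dmin.
exists B; split=> // x Sx.
have Sup i y : S y -> (y *m \adj B) 0 i != 0 ->
    (`|\det B| <= `|((y *m \adj B) ord0 i)%R|)%N.
  move=> Sy y0; pose B' := \matrix_(k, j) (if k == i then y 0 j else B k j).
  have dB' : \det B' = (y *m \adj B) 0 i.
    rewrite (expand_det_row _ i) mxE; apply: eq_bigr => j _.
    rewrite !mxE eqxx; congr (_ * _); rewrite /cofactor; congr (_ * \det _).
    by apply/matrixP => k l; rewrite !mxE eq_sym (negPf (neq_lift _ _)).
  rewrite -dB' {1}Ed; apply: dmin; apply/asboolP; exists B'; split=> //; last by rewrite dB'.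
  move=> k; have [->|ki] := eqVneq k i.
    by rewrite (_ : row i B' = y) //; apply/rowP => j; rewrite !mxE eqxx.
  by rewrite (_ : row k B' = row k B) //; apply/rowP => j; rewrite !mxE (negPf ki).
have divB i : (\det B %| ((x *m \adj B) ord0 i)%R)%Z.
  set t := (x *m _) _ _; apply/dvdz_mod0P/eqP; apply: contraT => r0.
  pose y := x - (t %/ \det B)%Z *: row i B.
  have yE : (y *m \adj B) 0 i = (t %% \det B)%Z.
    rewrite mulmxBl -scalemxAl -row_mul mul_mx_adj !mxE eqxx mulr1n.
    by apply/eqP; rewrite subr_eq addrC -divz_eq /t mxE.
  have Sy : S y by apply: SD => //; apply: SN; exact: SZ.
  have := Sup i y Sy; rewrite yE => /(_ r0).
  by rewrite leqNgt -ltz_nat !abszE (ger0_norm (modz_ge0 _ dB)) ltz_mod.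
exists (\row_i ((x *m \adj B) ord0 i %/ \det B)%Z).
set w := \row_i _; have wE : \det B *: w = x *m \adj B.
  by apply/rowP => i; rewrite [LHS]mxE [X in _ * X]mxE mulrC divzK.
have : \det B *: (w *m B) = \det B *: x.
  by rewrite scalemxAl wE -mulmxA mul_adj_mx mul_mx_scalar.
by move=> /rowP E; apply/rowP => i; move: (E i); rewrite !mxE => /(mulfI dB) ->.
Qed.

Lemma zlattice_between (V : vectType rat) (L M : set V) (N : nat) :
    zlattice L -> (0 < N)%N -> (forall x, L x -> M x) ->
    (forall x y, M x -> M y -> M (x + y)) -> (forall x, M x -> M (- x)) ->
    (forall x, M x -> L (x *+ N)) -> zlattice M.
Proof.
move=> [b [bV LE]] N0 LM MD MN ML.
have M0 : M 0 by apply: LM; rewrite LE; exact: intSpan0.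
set n := (\dim {:V})%N in b bV LE.
have N0' : N%:R != 0 :> rat by rewrite pnatr_eq0 -lt0n.
pose vec (x : 'rV[int]_n) : V := N%:R^-1 *: \sum_(i < n) b`_i *~ x 0 i.
have vecD x y : vec (x + y) = vec x + vec y.
  rewrite /vec -scalerDr -big_split; congr (_ *: _); apply: eq_bigr => i _.
  by rewrite mxE mulrzDr.
have vecN x : vec (- x) = - vec x.
  by rewrite /vec -scalerN -sumrN; congr (_ *: _); apply: eq_bigr => i _; rewrite mxE mulrNz.
have bL (i : 'I_n) : L b`_i by rewrite LE; exact: intSpan_nth.
have bM (i : 'I_n) : M b`_i by apply: LM.
have [||||B [SB hB]] := @subgroup_basis n (fun x => M (vec x)) N.
- by rewrite -lt0n in N0 *; lia.
- by move=> x y Mx My; rewrite vecD; exact: MD.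
- by move=> x Mx; rewrite vecN; exact: MN.
- move=> x; have -> : vec (N%:Z *: x) = \sum_(i < n) b`_i *~ x 0 i.
    apply: (scalerI N0'); rewrite /vec scalerA mulfV // scale1r scaler_sumr.
    apply: eq_bigr => i _; rewrite mxE mulrC mulrzA -pmulrn.
    by rewrite scaler_nat.
  by apply: addclosed_sum => // i; exact: addclosed_mulz.
pose c := [tuple vec (row i B) | i < n].
have vecB (w : 'rV_n) : vec (w *m B) = \sum_(i < n) c`_i *~ w 0 i.
  have vec0 : vec 0 = 0.
    by rewrite /vec big1 ?scaler0 // => i _; rewrite mxE mulr0z.
  rewrite mulmx_sum_row (big_morph vec vecD vec0); apply: eq_bigr => i _.
  rewrite -tnth_nth tnth_mktuple /vec scalerMzr mulrz_suml; congr (_ *: _).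
  by apply: eq_bigr => j _; rewrite !mxE mulrC mulrzA.
have ME : M = [set v | inIntSpan c v]%classic.
  apply/seteqP; split=> v /=.
    move=> Mv; have := ML _ Mv; rewrite LE /= => -[u Eu].
    have Ev : v = vec (\row_i u i).
      rewrite /vec; under eq_bigr do rewrite mxE.
      by rewrite -Eu -scaler_nat scalerA mulVf // scale1r.
    have [|w Ew] := hB (\row_i u i); first by rewrite -Ev.
    exists [ffun i => w 0 i]; rewrite Ev Ew vecB.
    by apply: eq_bigr => i _; rewrite ffunE.
  move=> [u ->]; apply: addclosed_sum => // i; apply: addclosed_mulz => //.
  rewrite -tnth_nth tnth_mktuple; exact: SB.
exists c; split=> //.
rewrite basisEdim size_tuple leqnn andbT.
apply/subvP => v _.
have vb : v \in <<b>>%VS by rewrite (span_basis bV) memvf.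
rewrite (coord_span vb).
apply: rpred_sum => i _; apply: rpredZ.
have := bM i; rewrite ME /= => -[u ->]; apply: rpred_sum => j _.
by apply: rpredMz; apply: memv_span; rewrite mem_nth ?size_tuple.
Qed.

(** * Reduced trace and norm, orders and trace duals *)

Definition conj_of (A : falgType rat) (tr : A -> rat) (x : A) : A :=
  (tr x)%:A - x.

(** The factor 2 is the reduced trace of 1. *)
Definition norm_of (A : falgType rat) (tr : A -> rat) (x : A) : rat :=
  tr (x * conj_of tr x) / 2%:R.

Record definite_trace (A : falgType rat) (tr : A -> rat) : Prop := {
  trD : {morph tr : x y / x + y};
  trZ : forall a x, tr (a *: x) = a * tr x;
  tr1 : tr 1 = 2%:R;
  trC : forall x y, tr (x * y) = tr (y * x);
  mul_conj : forall x, x * conj_of tr x = (norm_of tr x)%:A;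
  conjM : forall x y, conj_of tr (x * y) = conj_of tr y * conj_of tr x;
  norm_gt0 : forall x, x != 0 -> 0 < norm_of tr x }.

Section DefiniteTrace.
Variables (A : falgType rat) (tr : A -> rat) (htr : definite_trace tr).
Implicit Types x y z u : A.

Local Notation cj := (conj_of tr).
Local Notation nm := (norm_of tr).

Let trD := trD htr.
Let trZ := trZ htr.
Let tr1 := tr1 htr.
Let trC := trC htr.

Lemma tr0 : tr 0 = 0. Proof. by rewrite -(scale0r 0) trZ mul0r. Qed.
Lemma trN x : tr (- x) = - tr x. Proof. by rewrite -scaleN1r trZ mulN1r. Qed.
Lemma trB x y : tr (x - y) = tr x - tr y. Proof. by rewrite trD trN. Qed.
Lemma tr_sum I (r : seq I) (F : I -> A) : tr (\sum_(i <- r) F i) = \sum_(i <- r) tr (F i).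
Proof. exact: (big_morph tr trD tr0). Qed.
Lemma tr_scalar (a : rat) : tr a%:A = a * 2%:R. Proof. by rewrite trZ tr1. Qed.

Lemma scalar_inj : injective (fun a : rat => a%:A : A).
Proof.
move=> a b /eqP; rewrite -subr_eq0 -scalerBl scaler_eq0 oner_eq0 orbF subr_eq0.
by move=> /eqP.
Qed.

Lemma conjD x y : cj (x + y) = cj x + cj y.
Proof. by rewrite /conj_of trD scalerDl opprD addrACA. Qed.
Lemma conjZ a x : cj (a *: x) = a *: cj x.
Proof. by rewrite /conj_of trZ -scalerA -scalerBr. Qed.
Lemma conjN x : cj (- x) = - cj x.
Proof. by rewrite -scaleN1r conjZ scaleN1r. Qed.
Lemma conj_scalar (a : rat) : cj a%:A = a%:A.
Proof. by rewrite /conj_of tr_scalar -scalerBl; congr (_ *: _); ring. Qed.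
Lemma conj1 : cj 1 = 1. Proof. by rewrite -[1]scale1r conj_scalar. Qed.
Lemma tr_conj x : tr (cj x) = tr x.
Proof. by rewrite /conj_of trB tr_scalar; ring. Qed.
Lemma conjK x : cj (cj x) = x.
Proof. by rewrite {1}/conj_of tr_conj subKr. Qed.
Lemma add_conj x : x + cj x = (tr x)%:A.
Proof. by rewrite addrC subrK. Qed.
Lemma conj_mul x : cj x * x = (nm x)%:A.
Proof. by rewrite -mul_conj // mulrBl mulrBr -scalerAl mul1r -scalerAr mulr1. Qed.
Lemma normE x : nm x = (tr x ^+ 2 - tr (x * x)) / 2%:R.
Proof. by rewrite /norm_of mulrBr -scalerAr mulr1 trB trZ -expr2. Qed.
Lemma norm_scalar (a : rat) : nm a%:A = a ^+ 2.
Proof. by apply: scalar_inj; rewrite -mul_conj // conj_scalar -scalerAl mul1r scalerA. Qed.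
Lemma norm1 : nm 1 = 1. Proof. by rewrite -[1]scale1r norm_scalar expr1n. Qed.
Lemma normM x y : nm (x * y) = nm x * nm y.
Proof.
apply: scalar_inj; rewrite -mul_conj // conjM // mulrA -[x * y * _]mulrA.
by rewrite mul_conj // -scalerAr mulr1 -scalerAl mul_conj // scalerA mulrC.
Qed.
Lemma norm_conj x : nm (cj x) = nm x.
Proof. by apply: scalar_inj; rewrite -mul_conj // conjK conj_mul. Qed.
Lemma normZ a x : nm (a *: x) = a ^+ 2 * nm x.
Proof.
rewrite -[a *: x]mulr1 -scalerAl scalerAr -[LHS]mulr1 -norm1 -!normM.
by rewrite -norm_scalar -normM mulr1 -scalerAl mul1r -scalerAr mulr1.
Qed.
Lemma normN x : nm (- x) = nm x.
Proof. by rewrite -scaleN1r normZ sqrrN expr1n mul1r. Qed.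
Lemma normD x y : nm (x + y) = nm x + nm y + tr (x * cj y).
Proof.
have -> : tr (x * cj y) = (tr (x * cj y) + tr (y * cj x)) / 2%:R.
  by rewrite -[tr (y * _)]tr_conj conjM // conjK; field.
by rewrite /norm_of conjD mulrDl !mulrDr !trD; field.
Qed.
Lemma norm_eq0 x : nm x = 0 -> x = 0.
Proof. by have [//|/(norm_gt0 htr)] := eqVneq x 0; move=> /[swap] ->; rewrite ltxx. Qed.
Lemma norm0 : nm 0 = 0.
Proof. by rewrite -(scale0r 0) normZ expr0n mul0r. Qed.
Lemma tr_mul_conj x : tr (x * cj x) = 2%:R * nm x.
Proof. by rewrite mul_conj // tr_scalar mulrC. Qed.
(** From [z u + conj (z u) = tr (z u)], multiplied by [z] on the right. *)
Lemma sandwich z u : z * u * z = tr (z * u) *: z - nm z *: cj u.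
Proof.
have E : z * u = (tr (z * u))%:A - cj u * cj z.
  by apply/eqP; rewrite eq_sym subr_eq -conjM // add_conj.
rewrite [in LHS]E.
by rewrite mulrBl -scalerAl mul1r -mulrA conj_mul -scalerAr mulr1.
Qed.
End DefiniteTrace.

(** A prime dividing the denominator of [q] would divide the denominators of its
    powers to arbitrarily high order. *)
Lemma int_of_bounded_powers (q : rat) (E : nat) : (0 < E)%N ->
  (forall k, E%:R * q ^+ k \is a Num.int) -> q \is a Num.int.
Proof.
move=> E0 qE; rewrite Qint_def.
pose b := `|denq q|%N; have bE : denq q = b by rewrite absz_denq.
suff b1 : (b <= 1)%N by rewrite bE; have := denq_gt0 q; rewrite bE; lia.
have bk k : (b ^ k %| E)%N.
  have /intrP[z Ez] := qE k.
  have : E%:Z * numq q ^+ k = z * denq q ^+ k.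
    apply: (@intr_inj rat); rewrite !intrM -Ez !rmorphXn /=.
    rewrite -{1}[q in RHS]divq_num_den; rewrite expr_div_n -mulrA divfK //.
    by rewrite expf_neq0 // intr_eq0 denq_neq0.
  move=> /(congr1 absz); rewrite !abszM !abszX absz_nat -/b => H.
  have : (b ^ k %| E * `|numq q| ^ k)%N by rewrite H dvdn_mull.
  rewrite Gauss_dvdl // coprimeXl // coprime_sym coprimeXl //.
  exact: coprime_num_den.
rewrite leqNgt; apply/negP => b1.
have := dvdn_leq E0 (bk E); rewrite leqNgt => /negP[]; exact: ltn_expl.
Qed.

Section Orders.
Variables (A : falgType rat) (tr : A -> rat) (htr : definite_trace tr).
Variables (O : set A) (hO : is_order O).
Implicit Types x y z u : A.

Local Notation cj := (conj_of tr).
Local Notation nm := (norm_of tr).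

Lemma order1 : O 1. Proof. by case: hO. Qed.
Lemma orderM x y : O x -> O y -> O (x * y). Proof. by case: hO => _ _; apply. Qed.
Lemma orderD x y : O x -> O y -> O (x + y).
Proof. by case: hO => -[b [_ ->]] _ _; exact: intSpanD. Qed.
Lemma orderN x : O x -> O (- x).
Proof. by case: hO => -[b [_ ->]] _ _; exact: intSpanN. Qed.
Lemma orderB x y : O x -> O y -> O (x - y).
Proof. by move=> Ox Oy; apply: orderD => //; exact: orderN. Qed.
Lemma order0 : O 0. Proof. by rewrite -(subrr 1); apply: orderB order1 order1. Qed.
Lemma orderMz x (z : int) : O x -> O (x *~ z).
Proof. by apply: addclosed_mulz; [exact: order0|exact: orderD|exact: orderN]. Qed.
Lemma orderZ x a : a \is a Num.int -> O x -> O (a *: x).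
Proof. by move=> /intrP[z ->] Ox; rewrite scaler_int; exact: orderMz. Qed.
Lemma order_sum I (r : seq I) (F : I -> A) : (forall i, O (F i)) -> O (\sum_(i <- r) F i).
Proof. by apply: addclosed_sum; [exact: order0|exact: orderD]. Qed.
Lemma orderX x k : O x -> O (x ^+ k).
Proof. by move=> Ox; elim: k => [|k IH]; rewrite ?exprS; [exact: order1|exact: orderM]. Qed.

Lemma tr_bounded : exists2 D : nat, (0 < D)%N & forall x, O x -> D%:R * tr x \is a Num.int.
Proof.
case: hO => -[b [_ OE]] _ _; set n := (\dim {:A})%N in b OE.
pose D := (\prod_(i < n) `|denq (tr (b`_i)%R)|)%N.
exists D; first by rewrite prodn_gt0 // => i; rewrite absz_gt0 denq_neq0.
move=> x; rewrite OE /= => -[u ->].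
rewrite tr_sum // mulr_sumr; apply: rpred_sum => i _.
rewrite -scaler_int trZ // mulrCA rpredM ?intr_int //.
rewrite /D (bigD1 i) //= natrM mulrAC rpredM //; last exact: natr_int.
by rewrite natr_absz gtr0_norm ?denq_gt0 // mulrC -numqE intr_int.
Qed.

(** The norms of the powers of [x] are the powers of its norm, and the norm has
    bounded denominators on a lattice. *)
Lemma norm_int x : O x -> nm x \is a Num.int.
Proof.
have [D D0 hD] := tr_bounded.
move=> Ox; apply: (@int_of_bounded_powers _ (2 * D ^ 2)%N) => [|k].
  by rewrite muln_gt0 expn_gt0 D0.
have -> : nm x ^+ k = nm (x ^+ k).
  by elim: k => [|k IH]; rewrite ?norm1 // !exprS normM // IH.
have Oxk : O (x ^+ k) by exact: orderX.
move: (x ^+ k) Oxk => {Ox}x Ox; rewrite normE // natrM natrX.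
have -> : 2%:R * D%:R ^+ 2 * ((tr x ^+ 2 - tr (x * x)) / 2%:R) =
  (D%:R * tr x) ^+ 2 - D%:R * (D%:R * tr (x * x)) by field.
apply: rpredB; first by apply: rpredX; exact: hD.
by apply: rpredM; [exact: natr_int | apply: hD; exact: orderM].
Qed.

Lemma tr_int x : O x -> tr x \is a Num.int.
Proof.
move=> Ox; have -> : tr x = nm (x + 1) - nm x - 1.
  by rewrite normD // norm1 // conj1 // mulr1; ring.
by rewrite !rpredB ?norm_int ?rpred1 //; apply: orderD Ox order1.
Qed.

Lemma order_conj x : O x -> O (cj x).
Proof. by move=> Ox; apply: orderB => //; apply: orderZ order1; exact: tr_int. Qed.

Definition trdual z := forall y, O y -> tr (z * y) \is a Num.int.

Lemma order_dual x : O x -> trdual x.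
Proof. by move=> Ox y Oy; apply: tr_int; exact: orderM. Qed.
Lemma dualD x y : trdual x -> trdual y -> trdual (x + y).
Proof. by move=> dx dy w Ow; rewrite mulrDl trD // rpredD ?dx ?dy. Qed.
Lemma dualZ a x : a \is a Num.int -> trdual x -> trdual (a *: x).
Proof. by move=> ia dx w Ow; rewrite -scalerAl trZ // rpredM ?dx. Qed.
Lemma dualN x : trdual x -> trdual (- x).
Proof. by move=> dx w Ow; rewrite mulNr trN // rpredN dx. Qed.
Lemma dualB x y : trdual x -> trdual y -> trdual (x - y).
Proof. by move=> dx dy; apply: dualD => //; exact: dualN. Qed.
Lemma dualMr x y : trdual x -> O y -> trdual (x * y).
Proof. by move=> dx Oy w Ow; rewrite -mulrA dx //; exact: orderM. Qed.
Lemma dualMl x y : O x -> trdual y -> trdual (x * y).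
Proof. by move=> Ox dy w Ow; rewrite trC // mulrA trC // dy //; exact: orderM. Qed.
Lemma dual_conj x : trdual x -> trdual (cj x).
Proof.
move=> dx w Ow; rewrite -tr_conj // conjM // conjK // trC //.
by apply: dx; exact: order_conj.
Qed.
(** The determinant of the Gram matrix of the trace pairing works, by Cramer's
    rule; it is nonzero because [tr (x * conj x)] is twice the norm of [x]. *)
Lemma dual_bounded : exists2 N : nat, (0 < N)%N & forall z, trdual z -> O (z *+ N).
Proof.
have [[b [bV OE]] _ _] := hO; set n := (\dim {:A})%N in b bV OE.
have bO (i : 'I_n) : O b`_i by rewrite OE; exact: intSpan_nth.
have /(@choice _ _ _) [T hT] : forall ij : 'I_n * 'I_n,
    exists t : int, tr (b`_ij.1 * b`_ij.2) = t%:~R.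
  by move=> [i j]; apply/intrP/tr_int; exact: orderM.
pose M : 'M[int]_n := \matrix_(i, j) T (i, j).
have vecE x : x = \sum_(i < n) coord b i x *: b`_i.
  by rewrite -coord_span // (span_basis bV) memvf.
have trE x (j : 'I_n) : tr (x * b`_j) = ((\row_i coord b i x) *m map_mx intr M) 0 j.
  rewrite {1}(vecE x) mulr_suml tr_sum // mxE; apply: eq_bigr => i _.
  by rewrite -scalerAl trZ // (hT (i, j)) !mxE.
have dM : \det M != 0.
  apply/negP => /eqP d0.
  have : \det (map_mx (intr : int -> rat) M) == 0 by rewrite det_map_mx d0.
  move=> /det0P[v v0 vM].
  pose x := \sum_(i < n) v 0 i *: b`_i.
  have cx i : coord b i x = v 0 i.
    by rewrite coord_sum_free // (basis_free bV).
  have x0 : x != 0.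
    apply: contra_neq v0 => x0; apply/rowP => i.
    by rewrite mxE -cx x0 linear0.
  have : tr (x * cj x) = 0.
    rewrite [cj x]vecE mulr_sumr tr_sum // big1 // => j _.
    rewrite -scalerAr trZ // trE (_ : \row_i _ = v) ?vM ?mxE ?mulr0 //.
    by apply/rowP => i; rewrite mxE cx.
  rewrite tr_mul_conj // => /eqP; rewrite mulf_eq0 pnatr_eq0 /= => /eqP.
  by move=> /(norm_eq0 htr) /eqP; rewrite (negPf x0).
exists `|\det M|%N; first by rewrite absz_gt0.
move=> z dz.
suff Oz : O (z *~ \det M).
  rewrite pmulrn abszE; have [d0|d0] := ger0P (\det M) => //.
  by rewrite mulrNz; exact: orderN.
have /(@choice _ _ _) [t ht] : forall j : 'I_n, exists k : int, tr (z * b`_j) = k%:~R.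
  by move=> j; apply/intrP/dz.
have ct : (\det M)%:~R *: (\row_i coord b i z) = map_mx intr ((\row_j t j) *m \adj M).
  rewrite map_mxM map_mx_adj (_ : map_mx _ (\row_j t j) = (\row_i coord b i z) *m map_mx intr M).
    by rewrite -mulmxA mul_mx_adj mul_mx_scalar det_map_mx.
  by apply/rowP => j; rewrite -trE ht !mxE.
rewrite -scaler_int [z]vecE scaler_sumr; apply: order_sum => i.
rewrite scalerA; apply: orderZ (bO i).
move/rowP/(_ i): ct; rewrite [LHS]mxE [X in _ * X]mxE => ->.
by rewrite mxE intr_int.
Qed.

(** The additive group O + O z O. *)
Inductive adjoin z : A -> Prop :=
| AdjoinO x : O x -> adjoin z x
| AdjoinZ x y : O x -> O y -> adjoin z (x * z * y)
| AdjoinD x y : adjoin z x -> adjoin z y -> adjoin z (x + y).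

Lemma adjoinMl z a x : O a -> adjoin z x -> adjoin z (a * x).
Proof.
move=> Oa; elim=> {x}[x Ox|x y Ox Oy|x y _ hx _ hy].
- by apply: AdjoinO; exact: orderM.
- by rewrite !mulrA; apply: AdjoinZ => //; exact: orderM.
by rewrite mulrDr; exact: AdjoinD.
Qed.

Lemma adjoinMr z a x : O a -> adjoin z x -> adjoin z (x * a).
Proof.
move=> Oa; elim=> {x}[x Ox|x y Ox Oy|x y _ hx _ hy].
- by apply: AdjoinO; exact: orderM.
- by rewrite -mulrA; apply: AdjoinZ => //; exact: orderM.
by rewrite mulrDl; exact: AdjoinD.
Qed.

Lemma adjoinM z x y : trdual z -> nm z \is a Num.int ->
  adjoin z x -> adjoin z y -> adjoin z (x * y).
Proof.
move=> dz nz; elim=> {x}[x Ox|x y' Ox Oy'|x y' _ hx _ hy] zy.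
- exact: adjoinMl.
- elim: zy => {y}[y Oy|y w Oy Ow|y w _ hy _ hw].
  + by apply: adjoinMr => //; exact: AdjoinZ.
  + have -> : x * z * y' * (y * z * w) = x * (z * (y' * y) * z) * w by rewrite !mulrA.
    apply: adjoinMr => //; apply: adjoinMl => //.
    have Oyy : O (y' * y) by exact: orderM.
    rewrite (sandwich htr); apply: AdjoinD.
      set a := tr _; have -> : a *: z = a%:A * z * 1 by rewrite -scalerAl mul1r mulr1.
      apply: AdjoinZ order1.
      by apply: orderZ order1; exact: dz.
    by apply: AdjoinO; apply: orderN; apply: orderZ => //; exact: order_conj.
  by rewrite mulrDr; exact: AdjoinD.
by rewrite mulrDl; apply: AdjoinD; auto.
Qed.
End Orders.

(** O + O z O is an order, because [z u z] lies in Z z + O for [u] in O. It is a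
    lattice since it lies between O and its trace dual. *)
Lemma maximal_order_integral (A : falgType rat) (tr : A -> rat) (O : set A) z :
    definite_trace tr -> maximal_order O ->
  trdual tr O z -> norm_of tr z \is a Num.int -> O z.
Proof.
move=> htr [hO maxO] dz nz.
have [N N0 hN] := dual_bounded htr hO.
pose O' : set A := [set x | adjoin O z x]%classic.
have dO' x : O' x -> trdual tr O x.
  elim=> {x}[x Ox|x y Ox Oy|x y _ dx _ dy]; first exact: order_dual.
    by apply: dualMr => //; exact: dualMl.
  exact: dualD.
suff <- : O' = O by rewrite -[z]mulr1 -[z]mul1r; apply: AdjoinZ; exact: order1.
apply: maxO; last by move=> x; exact: AdjoinO.
split; [|by apply: AdjoinO; exact: (order1 hO)|by move=> x y; exact: (adjoinM htr hO dz nz)].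
have [LO _ _] := hO.
apply: (zlattice_between LO N0).
- by move=> x; exact: AdjoinO.
- by move=> x y; exact: AdjoinD.
- by move=> x hx; rewrite -mulN1r; apply: adjoinMl => //; apply: orderN (order1 hO).
by move=> x /dO'; exact: hN.
Qed.

(** * Arithmetic of a maximal order *)

Lemma intrFp_eq0 p (z : int) : prime p -> (z%:~R == 0 :> 'F_p) = (p %| z)%Z.
Proof.
move=> pr; case: z => z; rewrite ?NegzE ?rmorphN ?oppr_eq0 ?dvdzN //.
all: rewrite -(@dvdn_pcharf _ p) //; exact: pchar_Fp.
Qed.

Lemma intr_Fp_surj p (x : 'F_p) : exists z : int, x = z%:~R.
Proof. by exists (x : nat)%:Z; rewrite -pmulrn; exact/esym/natr_Zp. Qed.

(** Pigeonhole: squares take more than half of the values modulo [p], and so do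
    the [t - n y] for [y] a square. *)
Lemma binary_form_mod (p : nat) (n t : int) : prime p -> odd p -> ~~ (p %| n)%Z ->
  exists a b : int, (p %| a ^+ 2 + n * b ^+ 2 - t)%Z.
Proof.
move=> pr op; rewrite -intrFp_eq0 //; set N : 'F_p := n%:~R => N0.
pose S := [set x ^+ 2 | x : 'F_p]; pose T := [set t%:~R - N * y | y in S].
have cT : #|T| = #|S|.
  by apply: card_imset => x y /addrI/oppr_inj/(mulfI N0).
have cS : (p <= 2 * #|S|)%N.
  rewrite -[X in (X <= _)%N](card_Fp pr) -[X in (X <= _)%N]sum1_card mulnC -sum_nat_const.
  rewrite (partition_big (fun x : 'F_p => x ^+ 2) (mem S)) /=; last first.
    by move=> x _; apply: imset_f.
  apply: leq_sum => _ /imsetP[x _ ->]; rewrite sum1_card.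
  have sub : [pred y : 'F_p | y ^+ 2 == x ^+ 2] \subset [set x; - x].
    by apply/fintype.subsetP => y; rewrite !inE -eqf_sqr.
  by apply: leq_trans (subset_leq_card sub) _; rewrite cards2; case: eqP.
have : ~~ [disjoint S & T].
  apply/negP => /disjoint_setI0 ST0.
  have := max_card (mem (S :|: T)); rewrite cardsU ST0 cards0 subn0 cT card_Fp //.
  by move: op cS; lia.
move=> /pred0Pn[z /= /andP[/imsetP[x _ ->] /imsetP[_ /imsetP[y _ ->] E]]].
have [a Ea] := intr_Fp_surj x; have [b Eb] := intr_Fp_surj y.
exists a, b; rewrite -intrFp_eq0 // intrB intrD !intrM -!expr2 -Ea -Eb E.
by rewrite subrK subrr.
Qed.

Lemma int_parity (z : int) : exists m : int, z = 2 * m \/ z = 2 * m + 1.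
Proof. by exists (z %/ 2)%Z; lia. Qed.

Section MaximalOrder.
Variables (A : falgType rat) (tr : A -> rat) (htr : definite_trace tr).
Variables (O : set A) (hmax : maximal_order O).
Hypothesis noncomm : exists x y : A, x * y != y * x.
Implicit Types x y z u : A.

Local Notation cj := (conj_of tr).
Local Notation nm := (norm_of tr).
Local Notation dual := (trdual tr O).
Let hO : is_order O := hmax.1.

Let OD := orderD hO.
Let OB := orderB hO.
Let OM := orderM hO.
Let O1 := order1 hO.
Let OZ x (z : int) : O x -> O (z%:~R *: x).
Proof. by apply: (orderZ hO); exact: intr_int. Qed.

Lemma order_spans x : exists2 n : int, n != 0 & O (n%:~R *: x).
Proof.
have [[b [bV OE]] _ _] := hO; set n := (\dim {:A})%N in b bV OE.
have bO (i : 'I_n) : O b`_i by rewrite OE; exact: intSpan_nth.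
exists (\prod_(i < n) denq (coord b i x)).
  by apply/prodf_neq0 => i _; rewrite denq_neq0.
have -> : x = \sum_(i < n) coord b i x *: b`_i.
  by rewrite -coord_span // (span_basis bV) memvf.
set c := coord b; set D := \prod_(i < n) _.
have -> : D = \prod_(i < n) denq (c i x).
  by apply: eq_bigr => i _; congr denq; rewrite /c coord_sum_free // (basis_free bV).
rewrite scaler_sumr; apply: (order_sum hO) => i; rewrite scalerA.
apply: (orderZ hO) (bO i).
rewrite (bigD1 i) //= intrM mulrAC rpredM ?intr_int //.
by rewrite mulrC -numqE intr_int.
Qed.

(** Such an order would be commutative modulo [p]. Then commutators are divisible
    by [p]; expanding both arguments they are divisible by [p ^ 2], and so on, so
    they vanish. *)
Lemma order_not_binary (p : nat) (w : A) : (1 < p)%N -> O w ->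
  (forall x, O x -> exists (s t : int) (y : A),
     O y /\ x = (s%:~R)%:A + t%:~R *: w + p%:R *: y) -> False.
Proof.
move=> p1 Ow H.
pose co x y := x * y - y * x.
have coDl x y z : co (x + y) z = co x z + co y z.
  by rewrite /co mulrDl mulrDr opprD addrACA.
have coDr x y z : co x (y + z) = co x y + co x z.
  by rewrite /co mulrDl mulrDr opprD addrACA.
have coZl a x y : co (a *: x) y = a *: co x y.
  by rewrite /co -scalerAl -scalerAr scalerBr.
have coZr a x y : co x (a *: y) = a *: co x y.
  by rewrite /co -scalerAl -scalerAr scalerBr.
have co1l x : co 1 x = 0 by rewrite /co mul1r mulr1 subrr.
have co1r x : co x 1 = 0 by rewrite /co mul1r mulr1 subrr.
have coxx x : co x x = 0 by rewrite /co subrr.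
have coO k x y : O x -> O y -> exists2 z, O z & co x y = p%:R ^+ k *: z.
  elim: k x y => [|k IH] x y Ox Oy.
    by exists (co x y); rewrite ?scale1r //; apply: OB; exact: OM.
  have [s [t [x' [Ox' ->]]]] := H x Ox; have [s' [t' [y' [Oy' ->]]]] := H y Oy.
  have [z1 Oz1 E1] := IH w y' Ow Oy'.
  have [z2 Oz2 E2] := IH x' w Ox' Ow.
  have [z3 Oz3 E3] := IH x' y' Ox' Oy'.
  exists (t%:~R *: z1 + t'%:~R *: z2 + p%:Z%:~R *: z3).
    by apply: (OD (OD _ _) _); exact: OZ.
  rewrite !(coDl, coDr) !(coZl, coZr) !(co1l, co1r, coxx) !(scaler0, add0r, addr0).
  rewrite E1 E2 E3 !scalerDr !scalerA addrA exprSr.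
  congr (_ *: _ + _ *: _ + _ *: _); rewrite -?pmulrn; ring.
have {coO}Ocomm x y : O x -> O y -> co x y = 0.
  move=> Ox Oy; apply: (norm_eq0 htr).
  have Oc : O (co x y) by apply: OB; exact: OM.
  have /intrP[m Em] := norm_int htr hO Oc.
  have [z Oz Ez] := coO `|m|%N x y Ox Oy.
  have /intrP[q Eq] := norm_int htr hO Oz.
  move: Em; rewrite {1}Ez normZ // Eq -exprM => Em.
  have {}Em : (p%:Z ^+ (`|m| * 2)) * q = m.
    by apply: (@intr_inj rat); rewrite -Em intrM rmorphXn.
  rewrite Ez normZ // Eq.
  have [->|q0] := eqVneq q 0; first by rewrite mulr0.
  have : (`|m| < p ^ `|m|)%N by exact: ltn_expl.
  have : (p ^ `|m| <= `|m|)%N.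
    rewrite -{2}Em abszM abszX absz_nat expnM.
    apply: leq_trans (leq_pmulr _ _); last by rewrite absz_gt0.
    by rewrite -{1}[(p ^ _)%N]expn1 leq_pexp2l // expn_gt0 ltnW.
  by move=> h1 h2; have := leq_ltn_trans h1 h2; rewrite ltnn.
have [x [y /eqP]] := noncomm; apply.
have [n n0 Ox] := order_spans x; have [m m0 Oy] := order_spans y.
have := Ocomm _ _ Ox Oy; rewrite coZl coZr => /eqP.
by rewrite !scaler_eq0 !intr_eq0 (negPf n0) (negPf m0) /= subr_eq0 => /eqP.
Qed.

(** [p] times this set is the radical modulo [p] of the norm form on O. *)
Definition dual_layer (p : nat) z :=
  [/\ dual z, O (p%:R *: z) & p%:R * nm z \is a Num.int].

(** The product of two elements of the layer is [p^-1] times an element of O, since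
    it becomes integral after multiplication by [p]. If [x] is in the layer but not
    in O, then [u = p N(x)] is prime to [p]. For [y] in the layer, [p x conj(y)] is
    some [s + p z], and multiplying by [conj x] shows that [u y] is in Z x + O. So
    the layer is Z x + O, and O would be spanned by 1 and [p x] modulo [p]. *)
Lemma order_not_scalar_mod (p : nat) : prime p ->
  (forall x, O x -> exists (s : int) z, dual_layer p z /\ x = (s%:~R)%:A + p%:R *: z) ->
  False.
Proof.
move=> pr H; have p1 := prime_gt1 pr.
have MM x y : dual_layer p x -> dual_layer p y -> O (p%:R *: (x * y)).
  move=> [dx px nx] [dy py ny]; apply: (maximal_order_integral htr hmax).
    by rewrite scalerAl; apply: (dualMl htr hO).
  rewrite normZ // normM // expr2 mulrACA; exact: rpredM.
have Mc x : dual_layer p x -> dual_layer p (cj x).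
  move=> [dx px nx]; split; rewrite ?norm_conj //; first exact: (dual_conj htr hO).
  rewrite -conjZ //; exact: (order_conj htr hO).
have [[x [Mx nOx]]|noM] := pselect (exists x, dual_layer p x /\ ~ O x); last first.
  apply: (order_not_binary p1 O1) => x Ox; have [s [z [Mz Ez]]] := H x Ox.
  exists s, 0, z; split; last by rewrite scale0r addr0.
  by apply: contrapT => nz; apply: noM; exists z.
have [dx px /intrP[u Eu]] := Mx.
have cpu : coprime p `|u|%N.
  rewrite prime_coprime //; apply/negP => pu; apply: nOx.
  apply: (maximal_order_integral htr hmax) => //.
  have /dvdzP[q Eq] : (p %| u)%Z by rewrite dvdzE.
  suff -> : nm x = q%:~R by exact: intr_int.
  apply: (@mulfI _ p%:R); first by rewrite pnatr_eq0 -lt0n prime_gt0.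
  by rewrite Eu Eq intrM mulrC.
have [a [b ab]] : exists a b : int, a * u + b * p = 1.
  have : coprimez u p by rewrite coprimezE coprime_sym.
  by move=> /coprimezP[[a b] /= ab]; exists a, b.
have spanM y : dual_layer p y -> exists (r : int) v, O v /\ y = r%:~R *: x + v.
  move=> My; have [_ py _] := My.
  have Ow := MM _ _ Mx (Mc _ My).
  have [s [z [Mz Ez]]] := H _ Ow.
  pose v := p%:R *: (cj x * z); have Ov : O v by apply: MM => //; exact: Mc.
  have E : u%:~R *: cj y = s%:~R *: cj x + v.
    have : cj x * (p%:R *: (x * cj y)) = u%:~R *: cj y.
      by rewrite -scalerAr mulrA conj_mul // -scalerAl mul1r scalerA Eu.
    by rewrite Ez mulrDr -scalerAr mulr1 -scalerAr => <-.
  have {}E : u%:~R *: y = s%:~R *: x + cj v.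
    by move: (congr1 cj E); rewrite conjD // !conjZ // !conjK.
  exists (a * s), (a%:~R *: cj v + b%:~R *: (p%:R *: y)); split.
    by apply: OD; apply: OZ => //; exact: (order_conj htr hO).
  rewrite addrA intrM -scalerA -scalerDr -E !scalerA -scalerDl.
  rewrite -[p%:R]/(p%:Z%:~R) -!intrM -intrD ab scale1r //.
apply: (order_not_binary p1 px) => y Oy; have [s [z [Mz ->]]] := H y Oy.
have [r [v [Ov ->]]] := spanM z Mz.
exists s, r, v; split=> //.
by rewrite scalerDr !scalerA addrA; congr (_ + _ *: _ + _); rewrite mulrC.
Qed.

(** If all traces were even, the elements of even norm would form twice the
    layer at 2, and [x] or [x - 1] has even norm. *)
Lemma odd_trace : exists w (m : int), O w /\ tr w = (2 * m + 1)%:~R.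
Proof.
apply: contrapT => no_odd.
have ev x : O x -> exists m : int, tr x = (2 * m)%:~R.
  move=> Ox; have /intrP[z Ez] := tr_int htr hO Ox.
  have [m [zm|zm]] := int_parity z; exists m; rewrite Ez zm //.
  by case: no_odd; exists x, m; rewrite Ez zm.
have half x : O x -> (exists m : int, nm x = (2 * m)%:~R) -> dual_layer 2 (2%:R^-1 *: x).
  move=> Ox [m Em]; split.
  - move=> y Oy; have [k Ek] := ev _ (OM Ox Oy).
    by rewrite -scalerAl trZ // Ek intrM mulrA mulVf // mul1r intr_int.
  - by rewrite scalerA mulfV // scale1r.
  rewrite normZ // Em intrM.
  suff -> : 2%:R * (2%:R^-1 ^+ 2 * (2%:~R * m%:~R)) = m%:~R :> rat by exact: intr_int.
  by field.
apply: (@order_not_scalar_mod 2) => // x Ox.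
have /intrP[z Ez] := norm_int htr hO Ox.
have [m [zm|zm]] := int_parity z.
  exists 0, (2%:R^-1 *: x); split; first by apply: half => //; exists m; rewrite Ez zm.
  by rewrite scale0r add0r scalerA mulfV // scale1r.
exists 1, (2%:R^-1 *: (x - 1)); split; last first.
  by rewrite scale1r scalerA mulfV // scale1r addrC subrK.
apply: half; first exact: OB.
have [k Ek] := ev x Ox; exists (m - k + 1).
rewrite normD // normN // norm1 // conjN // conj1 // mulrN1 trN // Ez zm Ek.
by rewrite -rmorphN -[1]/(1%:~R) -!intrD; congr (_%:~R); ring.
Qed.

(** The trace of [(n z) (conj z) y] is [n N(z) tr(y)]; take [y = 1], of trace 2, and
    [y] of odd trace. *)
Lemma norm_dual (n : nat) z : dual z -> O (n%:R *: z) -> n%:R * nm z \is a Num.int.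
Proof.
move=> dz nz.
have H y : O y -> n%:R * nm z * tr y \is a Num.int.
  move=> Oy; have : tr (n%:R *: z * (cj z * y)) \is a Num.int.
    rewrite trC //; apply: (dualMr hO _ Oy) => //; exact: (dual_conj htr hO).
  by rewrite -scalerAl mulrA mul_conj // -scalerAl mul1r scalerA trZ.
have [w [m [Ow Ew]]] := odd_trace.
have -> : n%:R * nm z = n%:R * nm z * tr w - m%:~R * (n%:R * nm z * tr 1).
  by rewrite Ew tr1 // intrD intrM; ring.
by rewrite rpredB ?H // rpredM ?intr_int ?H.
Qed.
End MaximalOrder.

(** * The twisting element *)

Section Twist.
Variables (A : falgType rat) (tr : A -> rat) (htr : definite_trace tr).
Variables (O : set A) (hmax : maximal_order O).
Hypothesis noncomm : exists x y : A, x * y != y * x.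
Implicit Types x y z u : A.

Local Notation cj := (conj_of tr).
Local Notation nm := (norm_of tr).
Local Notation dual := (trdual tr O).
Let hO : is_order O := hmax.1.

Let OD := orderD hO.
Let OB := orderB hO.
Let OM := orderM hO.
Let O1 := order1 hO.
Let OZ x (z : int) : O x -> O (z%:~R *: x).
Proof. by apply: (orderZ hO); exact: intr_int. Qed.
Let dual_in z := maximal_order_integral htr hmax (z := z).
Let norm_dual := norm_dual htr hmax noncomm.

Lemma dual_mul (d : nat) x y : (forall z, dual z -> O (d%:R *: z)) ->
  dual x -> dual y -> O (d%:R *: (x * y)).
Proof.
move=> hd dx dy; apply: dual_in.
  by rewrite scalerAl; apply: (dualMl htr hO) => //; exact: hd.
by rewrite normZ // normM // expr2 mulrACA; apply: rpredM; apply: norm_dual => //; exact: hd.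
Qed.

(** If [p] divides the norm of [e] then [e c] has integral norm, so it lies in O;
    multiplying by [p conj(c)] shows that [e / p] is in the dual. Hence the
    elements of norm divisible by [p] are [p] times the layer. For odd [p], some
    [2 w - tr w] has norm prime to [p], since otherwise O would be Z plus [p]
    times the layer; it spans with 1 a nondegenerate binary form. *)
Lemma norm_surj_mod (p : nat) (c : A) (u t : int) : prime p ->
    dual c -> O (p%:R *: c) -> p%:R * nm c = u%:~R -> ~~ (p %| u)%Z ->
  exists y (n : int), [/\ O y, nm y = n%:~R & (p %| n - t)%Z].
Proof.
move=> pr dc pc Eu pu.
have p0 : p%:R != 0 :> rat by rewrite pnatr_eq0 -lt0n prime_gt0.
have aniso e (q : int) : O e -> nm e = p%:R * q%:~R -> dual_layer tr O p (p%:R^-1 *: e).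
  move=> Oe Ee.
  have Oec : O (e * c).
    apply: dual_in; first exact: (dualMl htr hO).
    by rewrite normM // Ee mulrAC Eu -intrM intr_int.
  have de : dual (p%:R^-1 *: e).
    move=> y Oy; have /intrP[k Ek] : tr (e * c * (cj c * y)) \is a Num.int.
      rewrite trC //; apply: (dualMr hO _ Oy) => //; exact: (dual_conj htr hO).
    have /intrP[m Em] := tr_int htr hO (OM Oe Oy).
    have {Ek} : u * m = p%:Z * k.
      apply: (@intr_inj rat); rewrite !intrM -Em -Ek -Eu.
      rewrite -[e * c * _]mulrA [c * _]mulrA mul_conj // -scalerAl mul1r -scalerAr trZ //.
      by rewrite -pmulrn -mulrA.
    move=> um; have : (p %| u * m)%Z by rewrite um dvdz_mulr.
    rewrite Gauss_dvdzr; last first.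
      by rewrite coprimezE prime_coprime // -dvdzE.
    move=> /dvdzP[q' Eq']; rewrite -scalerAl trZ // Em Eq' intrM.
    by rewrite mulrCA -pmulrn mulVf // mulr1 intr_int.
  have pe : p%:R *: (p%:R^-1 *: e) = e by rewrite scalerA mulfV // scale1r.
  by split; rewrite ?norm_dual ?pe.
have [p2|op] := eqVneq p 2%N.
  have [m [tm|tm]] := int_parity t; [exists 0, 0|exists 1, 1].
    by rewrite norm0 // tm p2; split=> //; [exact: (order0 hO) | lia].
  by rewrite norm1 // tm p2; split=> //; lia.
have {}op : odd p by case: (even_prime pr) op => // ->.
have [w [n [Ow Tw En pn]]] : exists w (n : int),
    [/\ O w, tr w = 0, nm w = n%:~R & ~~ (p %| n)%Z].
  apply: contrapT => no_w; apply: (order_not_scalar_mod htr hmax noncomm pr) => x Ox.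
  have /intrP[s Es] := tr_int htr hO Ox.
  pose w := 2%:R *: x - (tr x)%:A.
  have Ow : O w.
    apply: OB; last by rewrite Es; exact: OZ.
    by apply: (orderZ hO) => //; exact: natr_int.
  have /intrP[n En] := norm_int htr hO Ow.
  have /dvdzP[q Eq] : (p %| n)%Z.
    apply: contrapT => /negP pn; apply: no_w; exists w, n; split=> //.
    by rewrite trB // trZ // tr_scalar //; ring.
  have Enq : nm w = p%:R * q%:~R by rewrite En Eq intrM mulrC.
  have [dw pw _] := aniso w q Ow Enq.
  (* Multiplying by (p + 1) / 2 inverts 2 modulo p in 2 x = tr x + w. *)
  have Ep : p = (p./2).*2.+1 by rewrite -{1}(odd_double_half p) op.
  set k := p./2 in Ep; pose z := k.+1%:R *: (p%:R^-1 *: w) - x.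
  exists (k.+1%:Z * s), z.
  have dz : dual z.
    apply: (dualB htr); last exact: (order_dual htr hO).
    by apply: (dualZ htr) => //; exact: natr_int.
  have pz : O (p%:R *: z).
    rewrite scalerBr; apply: OB; last by rewrite pmulrn; exact: OZ.
    move: pw; set v := p%:R^-1 *: w => pw; rewrite scalerA mulrC -scalerA [k.+1%:R]pmulrn; exact: OZ.
  split; first by split=> //; exact: norm_dual.
  have -> : p%:R *: z = k.+1%:R *: w - p%:R *: x.
    rewrite /z scalerBr; congr (_ - _).
    by rewrite !scalerA mulrCA mulfV // mulr1.
  have -> : (k.+1%:Z * s)%:~R = k.+1%:R * tr x :> rat by rewrite intrM Es.
  rewrite scalerBr [k.+1%:R *: (tr x)%:A]scalerA addrCA addrA subrK scalerA -scalerBl.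
  rewrite -[LHS]scale1r; congr (_ *: _).
  by rewrite Ep -mul2n -[(2 * k).+1]addn1 natrD natrM -addn1 natrD; ring.
have [a [b ab]] := binary_form_mod t pr op pn.
exists (a%:~R%:A + b%:~R *: w), (a ^+ 2 + n * b ^+ 2); split=> //.
  by apply: OD; exact: OZ.
rewrite normD // norm_scalar // normZ // conjZ // -scalerAl mul1r trZ // trZ //.
rewrite tr_conj // Tw !mulr0 addr0 En intrD intrM !rmorphXn /=; ring.
Qed.

Definition dual_exponent (d : nat) :=
  [/\ (0 < d)%N, forall z, dual z -> O (d%:R *: z)
    & forall e, (0 < e < d)%N -> exists2 z, dual z & ~ O (e%:R *: z)].

Lemma exists_dual_exponent : exists d, dual_exponent d.
Proof.
have exd : exists d, `[< (0 < d)%N /\ forall z, dual z -> O (d%:R *: z) >].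
  have [N N0 hN] := dual_bounded htr hO; exists N; apply/asboolP; split=> // z dz.
  by rewrite scaler_nat; exact: hN.
case: (ex_minnP exd) => d /asboolP[d0 hd] dmin; exists d; split=> // e /andP[e0 ed].
apply: contrapT => noz; move: ed; rewrite ltnNge => /negP[]; apply: dmin.
apply/asboolP; split=> // z dz; apply: contrapT => nz; apply: noz.
by exists z.
Qed.

(** If [d = e p ^ 2] then [p e z] has norm [e (d N(z))], an integer, for every [z] in
    the dual; so [p e] would already map the dual into O. *)
Lemma dual_exponent_sqfree d p : dual_exponent d -> prime p -> ~~ (p ^ 2 %| d)%N.
Proof.
move=> [d0 hd dmin] pr; apply/negP => /dvdnP[e Ed].
have p1 := prime_gt1 pr; have p0 := prime_gt0 pr.
have e0 : (0 < e)%N by move: d0; rewrite Ed muln_gt0 => /andP[].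
have [|z dz] := dmin (p * e)%N; last apply.
  by rewrite muln_gt0 p0 e0 Ed expnS expn1 mulnC mulnA -[X in (X < _)%N]muln1 ltn_pmul2l // muln_gt0 e0.
apply: dual_in; first by apply: (dualZ htr) => //; exact: natr_int.
have /intrP[m Em] := norm_dual dz (hd z dz).
have -> : nm ((p * e)%:R *: z) = (e%:Z * m)%:~R.
  rewrite normZ // intrM -Em Ed !natrM !expr2; ring.
exact: intr_int.
Qed.

(** Multiply an element of the dual of order [p] modulo O by an element of O of
    suitable norm. *)
Lemma local_twist d e p : dual_exponent d -> prime p -> d = (p * e)%N ->
  exists c (k : int), [/\ dual c, O (p%:R *: c) & d%:R * nm c + 1 = p%:R * k%:~R].
Proof.
move=> hd pr Ed; have [d0 dO dmin] := hd; have p1 := prime_gt1 pr.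
have e0 : (0 < e)%N by move: d0; rewrite Ed muln_gt0 => /andP[].
have [|z dz nz] := dmin e; first by rewrite e0 Ed ltn_Pmull.
pose c := e%:R *: z; have dc : dual c by apply: (dualZ htr) => //; exact: natr_int.
have pc : O (p%:R *: c) by rewrite scalerA -natrM -Ed; exact: dO.
have /intrP[u Eu] := norm_dual dc pc.
have pu : ~~ (p %| u)%Z.
  apply/negP => /dvdzP[q Eq]; apply: nz; apply: dual_in => //.
  rewrite (_ : norm_of _ _ = q%:~R) ?intr_int //.
  apply: (@mulfI _ p%:R); first by rewrite pnatr_eq0 -lt0n prime_gt0.
  by rewrite -/c Eu Eq intrM mulrC.
have pe : ~~ (p %| e)%N.
  apply: contra (dual_exponent_sqfree hd pr) => pe.
  by rewrite Ed expnS expn1 dvdn_mul.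
have : coprimez (e%:Z * u) p.
  rewrite coprimezE coprime_sym prime_coprime // abszM Euclid_dvdM // negb_or.
  by rewrite pe -dvdzE.
move=> /coprimezP[[a b] /= ab].
have [y [n [Oy En /dvdzP[q Eq]]]] := norm_surj_mod (- a) pr dc pc Eu pu.
exists (c * y), (e%:Z * u * q + b); split.
- exact: (dualMr hO).
- by rewrite scalerAl; exact: OM.
rewrite normM // En Ed natrM.
have -> : p%:R * e%:R * (nm c * n%:~R) + 1 = (e%:Z * u * n + 1)%:~R.
  by rewrite intrD !intrM -Eu -pmulrn; ring.
rewrite pmulrn -intrM; congr (_%:~R); rewrite -ab.
have -> : n = q * p - a by lia.
ring.
Qed.

(** Solutions [b] and [c] for coprime divisors of [d] add up: either divisor times
    the cross term [tr (b conj(c))] is an integer, so the cross term is one. *)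
Lemma partial_twist d e : dual_exponent d -> (e %| d)%N ->
  exists b (k : int), [/\ dual b, O (e%:R *: b) & d%:R * nm b + 1 = e%:R * k%:~R].
Proof.
move=> hd; have [d0 dO _] := hd.
elim/ltn_ind: e => e IH ed.
have e0 : (0 < e)%N by exact: dvdn_gt0 ed.
have [e1|e1] := leqP e 1.
  have -> : e = 1%N by lia.
  exists 0, 1; split; [|by rewrite scaler0; exact: (order0 hO)|by rewrite norm0 // mulr0].
  exact/(order_dual htr hO)/(order0 hO).
have pr := pdiv_prime e1; set p := pdiv e in pr.
have /dvdnP[e' Ee] : (p %| e)%N := pdiv_dvd e.
have p1 := prime_gt1 pr; have e'0 : (0 < e')%N by move: e0; rewrite Ee muln_gt0 => /andP[].
have e'd : (e' %| d)%N by apply: dvdn_trans ed; rewrite Ee dvdn_mulr.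
have [|b [k [db eb Eb]]] := IH e' _ e'd; first by rewrite Ee ltn_Pmulr.
have /dvdnP[f Ed] := ed.
have [c [l [dc pc Ec]]] := @local_twist d (f * e')%N p hd pr ltac:(by rewrite Ed Ee; lia).
have cop : coprime p e'.
  rewrite prime_coprime //; apply: contra (dual_exponent_sqfree hd pr) => pe'.
  by apply: dvdn_trans ed; rewrite Ee expnS expn1 mulnC dvdn_mul.
have /intrP[nb Enb] := norm_dual db eb.
have /intrP[nc Enc] := norm_dual dc pc.
have /intrP[t Et] : tr (b * cj c) \is a Num.int.
  have /intrP[t1 Et1] : e'%:R * tr (b * cj c) \is a Num.int.
    by rewrite -trZ // scalerAl trC //; exact: (dual_conj htr hO dc eb).
  have /intrP[t2 Et2] : p%:R * tr (b * cj c) \is a Num.int.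
    by rewrite -trZ // scalerAr -conjZ //; apply: (db); exact: (order_conj htr hO).
  have /coprimezP[[a a'] /= aa'] : coprimez p e' by [].
  have -> : tr (b * cj c) = (a * p + a' * e')%:~R * tr (b * cj c) by rewrite aa' mul1r.
  rewrite intrD !intrM -!pmulrn mulrDl -!mulrA Et1 Et2 -!intrM -intrD; exact: intr_int.
exists (b + c).
have {}Ed : d%:R = f%:R * e'%:R * p%:R :> rat by rewrite Ed Ee !natrM; ring.
pose X : int := f%:Z * p%:Z * nb + f%:Z * e'%:Z * nc + f%:Z * e'%:Z * p%:Z * t + 1.
have EX : d%:R * nm (b + c) + 1 = X%:~R.
  rewrite normD // Et !intrD !intrM -Enb -Enc -!pmulrn Ed; ring.
have dX : (e%:Z %| X)%Z.
  rewrite Ee PoszM Gauss_dvdz; last by rewrite coprimezE coprime_sym.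
  have Hk : f%:Z * p%:Z * nb + 1 = e'%:Z * k.
    apply: (@intr_inj rat); rewrite intrD !intrM -Enb -!pmulrn -Eb Ed; ring.
  have Hl : f%:Z * e'%:Z * nc + 1 = p%:Z * l.
    apply: (@intr_inj rat); rewrite intrD !intrM -Enc -!pmulrn -Ec Ed; ring.
  have -> : X = e'%:Z * (k + f%:Z * nc + f%:Z * p%:Z * t) by rewrite /X; lia.
  rewrite dvdz_mulr //=.
  have -> : e'%:Z * (k + f%:Z * nc + f%:Z * p%:Z * t) =
      p%:Z * (l + f%:Z * nb + f%:Z * e'%:Z * t) by lia.
  by rewrite dvdz_mulr.
have /dvdzP[m Em] := dX; exists m; split.
- exact: (dualD htr).
- rewrite scalerDr Ee natrM; apply: OD.
    by rewrite mulrC -scalerA pmulrn; exact: OZ.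
  by rewrite -scalerA pmulrn; exact: OZ.
by rewrite EX Em intrM mulrC -pmulrn.
Qed.

End Twist.

(** * Descent of the reduced trace from the quaternions *)

Section RationalFunctional.
Variables (R : realFieldType) (A : falgType rat) (phi : A -> rat).
Hypothesis phiL : forall a x y, phi (a *: x + y) = a * phi x + phi y.

Definition ratr_functional (x : A) : R^o := ratr (phi x).

Lemma ratr_functional_linear : linear_for (ratr \; *:%R) ratr_functional.
Proof.
by move=> a x y; rewrite /ratr_functional phiL rmorphD rmorphM.
Qed.

HB.instance Definition _ :=
  GRing.isLinear.Build rat A R^o (ratr \; *:%R) ratr_functional
    ratr_functional_linear.

Lemma scalar_extension_functional (iota : {rmorphism A -> quat R}) :
    scalar_extension iota ->
  exists h : {linear quat R -> R^o}, forall x, h (iota x) = ratr (phi x).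
Proof.
move=> hiota.
have [h [hE _]] := hiota R^o (ratr_functional : {linear A -> R^o | ratr \; *:%R}).
by exists h => x; exact: hE.
Qed.
End RationalFunctional.

Section ReducedTrace.
Variables (R : realFieldType) (A : falgType rat).
Variables (iota : {rmorphism A -> quat R}) (hiota : scalar_extension iota).

(** A rational functional on A that vanishes on [U] but not at [v], extended to the
    real quaternions by scalar extension. *)
Lemma separating_functional (U : {vspace A}) v : v \notin U ->
  exists h : {linear quat R -> R^o},
    (forall x, x \in U -> h (iota x) = 0) /\ h (iota v) != 0.
Proof.
move=> vU; pose w := v - projv U v.
have w0 : w != 0.
  apply: contra vU; rewrite subr_eq0 => /eqP ->; exact: memv_proj.
have [i wi] : exists i, coord (vbasis {:A}) i w != 0.
  apply: contrapT => no; move: w0; rewrite [w](coord_vbasis (memvf _)) big1 ?eqxx // => i _.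
  by have [->|wi] := eqVneq (coord (vbasis {:A}) i w) 0; rewrite ?scale0r //; case: no; exists i.
have [|h hE] := @scalar_extension_functional R A
    (fun x => coord (vbasis {:A}) i (x - projv U x)) _ iota hiota.
  move=> a x y.
  have -> : a *: x + y - projv U (a *: x + y) =
      a *: (x - projv U x) + (y - projv U y).
    by rewrite [projv U _]linearP scalerBr opprD addrACA.
  exact: linearP.
exists h; split=> [x xU|]; last by rewrite hE fmorph_eq0.
by rewrite hE projv_id // subrr linear0 rmorph0.
Qed.

Lemma iota_inj : injective iota.
Proof.
suff inj0 x : iota x = 0 -> x = 0.
  by move=> x y xy; apply/eqP; rewrite -subr_eq0; apply/eqP/inj0; rewrite rmorphB xy subrr.
move=> ix; apply/eqP; apply: contraT => x0.
have [|h [_]] := @separating_functional 0%VS x; first by rewrite memv0.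
by rewrite ix linear0 eqxx.
Qed.

Lemma iotaZ a x : iota (a *: x) = ratr a *: iota x.
Proof.
have d0 : (denq a)%:~R != 0 :> R by rewrite intr_eq0 denq_neq0.
apply: (scalerI d0); rewrite scaler_int -rmorphMz -scaler_int scalerA.
rewrite mulrC -numqE scaler_int rmorphMz -scaler_int scalerA; congr (_ *: _).
by rewrite -ratr_int numqE rmorphM /= ratr_int mulrC.
Qed.

Definition qnorm (q : quat R) : R :=
  qre q ^+ 2 + qi q ^+ 2 + qj q ^+ 2 + qk q ^+ 2.

Lemma quat_square (q : quat R) : q * q = qtrace q *: q - qnorm q *: 1.
Proof. by case: q => a b c d; rewrite /qtrace /qnorm; apply: quatP => /=; ring. Qed.

(** Unless [x] is a scalar, its real quadratic equation is rational: a functional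
    vanishing at 1 and [x] must vanish at [x ^ 2], so [x ^ 2] is a rational
    combination of 1 and [x], whose coefficients are determined. *)
Lemma rational_trace x : exists t : rat, qtrace (iota x) = ratr t.
Proof.
have [/vlineP[a ->]|x1] := boolP (x \in 1%VS).
  exists (a * 2%:R); rewrite iotaZ rmorph1 rmorphM /= ratr_nat /qtrace /=; ring.
have not_real r : iota x <> r *: 1.
  move=> ix; have [h [h0]] := separating_functional x1.
  by rewrite ix linearZ /= -(rmorph1 iota) h0 ?memv_line // scaler0 eqxx.
have : x * x \in (1 + <[x]>)%VS.
  apply: contraT => /separating_functional[h [h0]].
  rewrite rmorphM quat_square linearB !linearZ /= -(rmorph1 iota).
  have xU : x \in (1 + <[x]>)%VS by rewrite (subvP (addvSr _ _)) ?memv_line.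
  have oneU : 1 \in (1 + <[x]>)%VS.
    by apply: (subvP (addvSl 1%VS _)); apply: memv_line.
  by rewrite !h0 // oppr0 !scaler0 addr0 eqxx.
case/memv_addP => _ /vlineP[a ->] [_ /vlineP[b ->]] E.
exists b; apply/eqP; apply: contraT => tb; 
case: (not_real ((ratr a + qnorm (iota x)) / (qtrace (iota x) - ratr b))).
have := congr1 iota E; rewrite rmorphM quat_square rmorphD !iotaZ rmorph1 => E'.
have t0 : qtrace (iota x) - ratr b != 0 by rewrite subr_eq0.
apply: (scalerI t0); rewrite scalerA mulrCA mulfV // mulr1 scalerBl.
move/eqP: E'; rewrite subr_eq => /eqP ->.
by rewrite addrAC addrK -scalerDl.
Qed.

Lemma exists_trace : exists tr : A -> rat,
  definite_trace tr /\ forall x, ratr (tr x) = qtrace (iota x).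
Proof.
have /choice[tr trE] := rational_trace; exists tr.
have ratr_inj : injective (ratr : rat -> R) by exact: fmorph_inj.
have cE x : iota (conj_of tr x) = qconj (iota x).
  rewrite /conj_of rmorphB iotaZ rmorph1 -trE.
  by case: (iota x) => a b c d; rewrite /qtrace; apply: quatP => /=; ring.
have nE x : ratr (norm_of tr x) = qnorm (iota x).
  rewrite /norm_of rmorphM fmorphV /= ratr_nat -trE rmorphM cE.
  by case: (iota x) => a b c d; rewrite /qtrace /qnorm /=; field.
split=> //; split.
- move=> x y; apply: ratr_inj; rewrite rmorphD /= -!trE rmorphD.
  by case: (iota x) (iota y) => a b c d [a' b' c' d']; rewrite /qtrace /=; ring.
- move=> a x; apply: ratr_inj; rewrite rmorphM /= -!trE iotaZ.
  by case: (iota x) => c d e f; rewrite /qtrace /=; ring.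
- by apply: ratr_inj; rewrite -trE rmorph1 ratr_nat /qtrace /=; ring.
- move=> x y; apply: ratr_inj; rewrite -!trE !rmorphM.
  by case: (iota x) (iota y) => a b c d [a' b' c' d']; rewrite /qtrace /=; ring.
- move=> x; apply: iota_inj; rewrite rmorphM cE iotaZ rmorph1 nE.
  by case: (iota x) => a b c d; rewrite /qnorm; apply: quatP => /=; ring.
- move=> x y; apply: iota_inj; rewrite rmorphM !cE rmorphM.
  by case: (iota x) (iota y) => a b c d [a' b' c' d']; apply: quatP => /=; ring.
move=> x x0; rewrite -(ltr0q R) nE.
have ix : iota x != 0 by rewrite -(rmorph0 iota) (inj_eq iota_inj).
have sq (a : R) := sqr_ge0 a.
rewrite lt0r; apply/andP; split; last by rewrite /qnorm !addr_ge0.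
apply: contra ix; rewrite /qnorm !paddr_eq0 ?addr_ge0 // !sqrf_eq0.
by move=> /andP[/andP[/andP[/eqP a /eqP b] /eqP c] /eqP e]; apply/eqP/quatP.
Qed.
End ReducedTrace.

Lemma quaternion_noncomm (A : falgType rat) : quaternion_algebra A ->
  exists x y : A, x * y != y * x.
Proof.
move=> [d4 Z1 _]; apply: contrapT => no.
suff : ({:A} <= 'Z({:A}))%VS by move/dimvS; rewrite d4 Z1 dimv1.
apply/subvP => x _; rewrite memv_cap memvf /=.
apply/centvP => y _; apply/eqP; apply: contraT => xy; by case: no; exists x, y.
Qed.

(** * The twisted hermitian form *)

Section TwistedForm.
Variables (A : falgType rat) (tr : A -> rat) (htr : definite_trace tr).
Variables (O : set A) (hmax : maximal_order O).
Hypothesis noncomm : exists x y : A, x * y != y * x.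
Hypothesis dimA : \dim {:A} = 4%N.
Variables (d : nat) (b : A).
Hypotheses (d0 : (0 < d)%N) (hd : forall z, trdual tr O z -> O (d%:R *: z)).
Hypotheses (db : trdual tr O b) (hb : norm_of tr b + d%:R^-1 \is a Num.int).
Implicit Types (x y z : A) (u v : A * A).

Local Notation cj := (conj_of tr).
Local Notation nm := (norm_of tr).
Local Notation dual := (trdual tr O).
Let hO : is_order O := hmax.1.
Let dQ0 : d%:R != 0 :> rat. Proof. by rewrite pnatr_eq0 -lt0n. Qed.

Definition twist u := u.1 + b * u.2.

(** The scalar product of the vectors [(x + b y, y / sqrt d)] of the quaternionic
    plane, in terms of the coordinates [u = (x, y)]. *)
Definition tform u v : rat :=
  tr (cj (twist u) * twist v) + d%:R^-1 * tr (cj u.2 * v.2).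

Lemma tformDl u u' v : tform (u + u') v = tform u v + tform u' v.
Proof.
have tD : twist (u + u') = twist u + twist u' by rewrite /twist mulrDr addrACA.
by rewrite /tform tD !conjD // !mulrDl !trD //; ring.
Qed.

Lemma tformZl a u v : tform (a *: u) v = a * tform u v.
Proof.
have tZ : twist (a *: u) = a *: twist u by rewrite /twist -scalerAr scalerDr.
by rewrite /tform tZ !conjZ // -!scalerAl !trZ //; ring.
Qed.

Lemma tformC u v : tform u v = tform v u.
Proof.
have cC x y : tr (cj x * y) = tr (cj y * x).
  by rewrite -tr_conj // conjM // conjK.
by rewrite /tform cC [tr (cj u.2 * _)]cC.
Qed.

Lemma tform_diag u : tform u u = 2%:R * (nm (twist u) + d%:R^-1 * nm u.2).
Proof. by rewrite /tform !conj_mul // !tr_scalar //; ring. Qed.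

Lemma tform_gt0 u : u != 0 -> 0 < tform u u.
Proof.
have dV : 0 < d%:R^-1 :> rat by rewrite invr_gt0 ltr0n.
have nm_ge0 x : 0 <= nm x.
  by have [->|x0] := eqVneq x 0; rewrite ?norm0 // ltW // norm_gt0.
case: u => x y; rewrite tform_diag pmulr_rgt0 //= => xy0.
have [y0|y0] := eqVneq y 0.
  have x0 : x != 0 by apply: contra_neq xy0 => ->; rewrite y0.
  by rewrite /twist /= y0 mulr0 addr0 norm0 // mulr0 addr0 norm_gt0.
by rewrite ltr_wpDl // mulr_gt0 // norm_gt0.
Qed.

Lemma tform_order x y x' y' : O x -> O y -> O x' -> O y' ->
  tform (x, y) (x', y') \is a Num.int.
Proof.
move=> Ox Oy Ox' Oy'; have Ocx := order_conj htr hO Ox; have Ocy := order_conj htr hO Oy.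
have dcb : dual (cj b) by exact: (dual_conj htr hO).
have -> : tform (x, y) (x', y') = tr (cj x * x') + tr (cj x * b * y') +
   tr (cj y * cj b * x') + (nm b + d%:R^-1) * tr (cj y * y').
  have E : cj y * cj b * (b * y') = nm b *: (cj y * y').
    by rewrite -mulrA [cj b * _]mulrA conj_mul // -scalerAl mul1r -scalerAr.
  rewrite /tform /twist /= conjD // conjM // mulrDl.
  rewrite (mulrDr (cj x)) (mulrDr (cj y * cj b)) E !trD // trZ // !mulrA.
  by ring.
rewrite !rpredD //.
- by apply: (tr_int htr hO); exact: (orderM hO).
- by apply: (dualMl htr hO Ocx db).
- by apply: (dualMl htr hO Ocy dcb).
by apply: rpredM => //; apply: (tr_int htr hO); exact: (orderM hO).
Qed.

Lemma tform_even x y : O x -> O y ->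
  exists m : int, tform (x, y) (x, y) = (2 * m)%:~R.
Proof.
move=> Ox Oy.
have /intrP[m Em] : nm (twist (x, y)) + d%:R^-1 * nm y \is a Num.int.
  rewrite /twist /= normD // normM //.
  have -> : nm x + nm b * nm y + tr (x * cj (b * y)) + d%:R^-1 * nm y =
    nm x + (nm b + d%:R^-1) * nm y + tr (x * cj (b * y)) by ring.
  have Ob : dual (cj (b * y)) by apply: (dual_conj htr hO); exact: (dualMr hO).
  apply: rpredD; last by rewrite trC //; apply: Ob.
  apply: rpredD; first exact: (norm_int htr hO).
  by apply: rpredM => //; exact: (norm_int htr hO).
by exists m; rewrite tform_diag intrM -Em.
Qed.

(** Put [u = x + b y]. Pairing with the first and the second factor shows that [u]
    and [conj(b) u + y / d] are in the dual of O. As [d] times a product of two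
    elements of the dual is in O, so is [y]; then [conj(b) x] is in the dual, and
    [x] is recovered from [d x] and [d b conj(b) x] because [N(b) + 1/d] is an
    integer. *)
Lemma tform_selfdual x y :
  (forall x' y', O x' -> O y' -> tform (x, y) (x', y') \is a Num.int) ->
  O x /\ O y.
Proof.
move=> H; set u := twist (x, y).
have O0 := order0 hO.
have du : dual u.
  rewrite -[u](conjK htr); apply: (dual_conj htr hO) => z Oz.
  have := H z 0 Oz O0; rewrite /tform /twist /= !mulr0 addr0 -/(twist (x, y)) -/u.
  by rewrite tr0 // mulr0 addr0.
have dv : dual (cj b * u + d%:R^-1 *: y).
  rewrite -[X in dual X](conjK htr); apply: (dual_conj htr hO) => z Oz.
  have := H 0 z O0 Oz; rewrite /tform /twist /= add0r -/(twist (x, y)) -/u.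
  have cE t : cj (cj b * t + d%:R^-1 *: y) = cj t * b + d%:R^-1 *: cj y.
    by rewrite conjD // conjM // conjK // conjZ.
  by rewrite cE (mulrDl (cj u * b)) -(scalerAl _ (cj y)) trD // trZ // mulrA.
have dcb : dual (cj b) by exact: (dual_conj htr hO).
have mulO z z' : dual z -> dual z' -> O (d%:R *: (z * z')).
  exact: (dual_mul htr hmax noncomm hd).
have Oy : O y.
  have -> : y = d%:R *: (cj b * u + d%:R^-1 *: y) - d%:R *: (cj b * u).
    by rewrite scalerDr scalerA mulfV // scale1r addrC addKr.
  by apply: (orderB hO); [exact: hd | exact: mulO].
split=> //.
have xE : x = u - b * y by rewrite /u /twist /= addrK.
have dx : dual x by rewrite xE; apply: (dualB htr) => //; exact: (dualMr hO).
have dcbx : dual (cj b * x).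
  have -> : cj b * x = (cj b * u + d%:R^-1 *: y) - (nm b + d%:R^-1) *: y.
    rewrite xE mulrBr mulrA conj_mul // -scalerAl mul1r scalerDl.
    by rewrite [nm b *: y + _]addrC opprD addrA addrK.
  apply: (dualB htr) => //; apply: (dualZ htr) => //; exact: (order_dual htr hO).
have -> : x = (nm b + d%:R^-1) *: (d%:R *: x) - d%:R *: (b * (cj b * x)).
  rewrite mulrA mul_conj // -scalerAl mul1r !scalerA -scalerBl.
  by rewrite mulrDl mulVf // [d%:R * _]mulrC addrAC subrr add0r scale1r.
apply: (orderB hO); last exact: mulO.
by apply: (orderZ hO) => //; exact: hd.
Qed.

(** [G] is the Gram matrix of the form on a basis [P] of O x O. Its inverse is
    integral: the rational vectors dual to [P] pair integrally with O x O, so they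
    belong to it. *)
Lemma tform_unimodular : exists (P : 'I_8 -> A * A) (G : 'M[int]_8),
  [/\ [/\ G \in unitmx, posdef (ratmx G) & even_form G],
      forall x y : 'rV[int]_8,
        tform (\sum_j P j *~ x 0 j) (\sum_j P j *~ y 0 j) = (gdot G x y)%:~R
    & forall x y, O x -> O y -> exists n : 'rV[int]_8, (x, y) = \sum_j P j *~ n 0 j]
   /\ forall n : 'rV[int]_8, O (\sum_j P j *~ n 0 j).1 /\ O (\sum_j P j *~ n 0 j).2.
Proof.
have [w [wV OE]] : exists w : 4.-tuple A,
    basis_of fullv w /\ O = [set v | inIntSpan w v]%classic.
  by have [+ _ _] := hO; rewrite /zlattice dimA.
have wO (i : 'I_4) : O w`_i by rewrite OE; exact: intSpan_nth.
have O0 := order0 hO.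
pose P (j : 'I_(4 + 4)) : A * A :=
  match fintype.split j with inl i => (w`_i, 0) | inr i => (0, w`_i) end.
have Pl i : P (lshift 4 i) = (w`_i, 0) by rewrite /P (unsplitK (inl i)).
have Pr i : P (rshift 4 i) = (0, w`_i) by rewrite /P (unsplitK (inr i)).
have PO j : O (P j).1 /\ O (P j).2 by rewrite /P; case: (fintype.split j) => i /=; split.
pose vec (q : 'rV[rat]_(4 + 4)) : A * A := \sum_j q 0 j *: P j.
have vecE (s t : 'rV_4) :
    vec (row_mx s t) = (\sum_(i < 4) s 0 i *: w`_i, \sum_(i < 4) t 0 i *: w`_i).
  rewrite /vec big_split_ord /=.
  under eq_bigr do rewrite row_mxEl Pl.
  under [X in _ + X]eq_bigr do rewrite row_mxEr Pr.
  have S1 (F : 'I_4 -> A) : \sum_i (F i, 0 : A) = (\sum_i F i, 0 : A).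
    by apply: (big_rec2 (fun u x => u = (x, 0))) => // i x y _ ->; congr pair; rewrite /= addr0.
  have S2 (F : 'I_4 -> A) : \sum_i (0 : A, F i) = (0 : A, \sum_i F i).
    by apply: (big_rec2 (fun u x => u = (0, x))) => // i x y _ ->; congr pair; rewrite /= addr0.
  have -> : \sum_(i < 4) s 0 i *: (w`_i, 0 : A) = \sum_(i < 4) (s 0 i *: w`_i, 0 : A).
    by apply: eq_bigr => i _; congr pair; rewrite /= scaler0.
  have -> : \sum_(i < 4) t 0 i *: (0 : A, w`_i) = \sum_(i < 4) (0 : A, t 0 i *: w`_i).
    by apply: eq_bigr => i _; congr pair; rewrite /= scaler0.
  by rewrite S1 S2; congr pair; rewrite /= ?addr0 ?add0r.
have wE x : x = \sum_(i < 4) coord w i x *: w`_i.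
  by rewrite -coord_span // (span_basis wV) memvf.
have vec_surj u : exists q, u = vec q.
  exists (row_mx (\row_i coord w i u.1) (\row_i coord w i u.2)).
  rewrite vecE; case: u => x y /=; congr pair.
    by rewrite {1}(wE x); apply: eq_bigr => i _; rewrite mxE.
  by rewrite {1}(wE y); apply: eq_bigr => i _; rewrite mxE.
have vec_int (q : 'rV_(4 + 4)) : O (vec q).1 -> O (vec q).2 -> exists n, q = ratmx n.
  have half (s : 'rV[rat]_4) : O (\sum_(i < 4) s 0 i *: w`_i) -> exists n, s = ratmx n.
    rewrite OE => -[n En]; exists (\row_i n i); apply/rowP => i.
    move: (congr1 (coord w i) En).
    under [in RHS]eq_bigr do rewrite -scaler_int.
    by rewrite !coord_sum_free ?(basis_free wV) // !mxE.
  rewrite -[q]hsubmxK vecE /= => /half[s ->] /half[t ->].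
  by exists (row_mx s t); rewrite map_row_mx.
have vec0 : vec 0 = 0 by rewrite /vec big1 // => j _; rewrite mxE scale0r.
have vec_inj0 (q : 'rV_(4 + 4)) : vec q = 0 -> q = 0.
  rewrite -[q]hsubmxK vecE => -[e1 e2].
  have z (s : 'rV[rat]_4) : \sum_(i < 4) s 0 i *: w`_i = 0 -> s = 0.
    move=> e; apply/rowP => i; rewrite mxE; move: (congr1 (coord w i) e).
    by rewrite coord_sum_free ?(basis_free wV) // linear0.
  by rewrite (z _ e1) (z _ e2) row_mx0.
have /(@choice _ _ _) [g hg] : forall ij : 'I_8 * 'I_8,
    exists t : int, tform (P ij.1) (P ij.2) = t%:~R.
  move=> [i j]; apply/intrP.
  have [a1 a2] := PO i; have [b1 b2] := PO j.
  by rewrite [P i]surjective_pairing [P j]surjective_pairing; exact: tform_order.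
pose G : 'M[int]_8 := \matrix_(i, j) g (i, j).
have tsuml (I : Type) (r : seq I) (F : I -> A * A) v :
    tform (\sum_(i <- r) F i) v = \sum_(i <- r) tform (F i) v.
  by apply: (big_morph (tform^~ v)) => [u u'|]; [exact: tformDl | rewrite -(scale0r 0) tformZl mul0r].
have tsumr (I : Type) (r : seq I) (F : I -> A * A) v :
    tform v (\sum_(i <- r) F i) = \sum_(i <- r) tform v (F i).
  by rewrite tformC tsuml; apply: eq_bigr => i _; rewrite tformC.
have gramE q q' : tform (vec q) (vec q') = gdot (ratmx G) q q'.
  rewrite /vec tsumr /gdot mxE; apply: eq_bigr => j _.
  rewrite tformC tformZl tformC tsuml !mxE mulrC; congr (_ * _).
  by apply: eq_bigr => i _; rewrite tformZl (hg (i, j)) !mxE.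
have vecz (n : 'rV[int]_(4 + 4)) : \sum_j P j *~ n 0 j = vec (ratmx n).
  by apply: eq_bigr => j _; rewrite mxE scaler_int.
have vecO (n : 'rV[int]_(4 + 4)) : O (vec (ratmx n)).1 /\ O (vec (ratmx n)).2.
  rewrite -[n]hsubmxK map_row_mx vecE /=.
  by split; apply: (order_sum hO) => i; apply: (orderZ hO) => //; rewrite mxE intr_int.
have pG : posdef (ratmx G).
  split=> [|q q0]; last by rewrite -gramE tform_gt0 //; apply: contra_neq q0; exact: vec_inj0.
  by apply/matrixP => i j; rewrite !mxE -(hg (i, j)) -(hg (j, i)) tformC.
exists P, G; split; last by move=> n; rewrite vecz; exact: vecO.
split; last first.
- move=> x y Ox Oy; have [q Eq] := vec_surj (x, y).
  have [||n En] := vec_int q; rewrite -?Eq //.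
  by exists n; rewrite vecz -En.
- by move=> x y; rewrite !vecz gramE -ratmx_gdot.
split=> //; last first.
  move=> n; have [Ox Oy] := vecO n; have [m Em] := tform_even Ox Oy.
  apply/dvdzP; exists m; apply: (@intr_inj rat).
  by rewrite ratmx_gdot -gramE mulrC -Em -surjective_pairing.
have uG : ratmx G \in unitmx.
  rewrite unitmxE unitfE; apply/negP => /det0P[q q0 qG].
  by have := pG.2 q q0; rewrite /gdot qG mul0mx mxE ltxx.
have /(@choice _ _ _) [H hH] : forall i : 'I_8, exists n : 'rV[int]_8,
    row i (invmx (ratmx G)) = ratmx n.
  move=> i; set q := row i _.
  have [Ox Oy] : O (vec q).1 /\ O (vec q).2.
    apply: tform_selfdual => x y Ox Oy; rewrite -surjective_pairing.
    have [q' Eq'] := vec_surj (x, y).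
    have [||n En] := vec_int q'; rewrite -?Eq' //.
    rewrite Eq' En gramE /gdot -row_mul mulVmx // row1 -rowE !mxE.
    exact: intr_int.
  exact: vec_int.
have : G *m \matrix_i H i = 1%:M.
  apply: ratmx_inj; rewrite map_mxM map_mx1 -(mulmxV uG); congr (_ *m _).
  by apply/row_matrixP => i; rewrite hH; apply/rowP => j; rewrite !mxE.
by move=> /mulmx1_unit[].
Qed.
End TwistedForm.

(** * The lattice in two copies of the quaternions *)

Lemma HHdotDl (R : realFieldType) (u u' v : HH R) :
  HHdot (u + u') v = HHdot u v + HHdot u' v.
Proof.
case: u u' v => -[? ? ? ?] [? ? ? ?] [[? ? ? ?] [? ? ? ?]] [[? ? ? ?] [? ? ? ?]].
by rewrite /HHdot /qtrace /=; ring.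
Qed.

Lemma HHdotZl (R : realFieldType) (a : R) (u v : HH R) :
  HHdot (a *: u) v = a * HHdot u v.
Proof.
case: u v => -[? ? ? ?] [? ? ? ?] [[? ? ? ?] [? ? ? ?]].
by rewrite /HHdot /qtrace /=; ring.
Qed.

Lemma dim_HH (R : realFieldType) : \dim {:HH R} = 8%N.
Proof. by rewrite dimvf. Qed.

(** A linear relation between the vectors, paired with each of them, is a row
    annihilated by the Gram matrix. *)
Lemma gram_basis (R : realFieldType) (e : 8.-tuple (HH R)) (G : 'M[int]_8) :
  G \in unitmx -> (forall i j : 'I_8, HHdot e`_i e`_j = (G i j)%:~R) ->
  basis_of fullv e.
Proof.
move=> uG eG; rewrite basisEfree subvf dim_HH size_tuple leqnn !andbT.
apply/freeP => c c0.
have H : (\row_i c i) *m map_mx intr G = 0.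
  apply/rowP => j; rewrite !mxE.
  transitivity (HHdot (\sum_(i < 8) c i *: e`_i) e`_j); last first.
    by rewrite c0 -(scale0r 0) HHdotZl mul0r.
  rewrite (big_morph (fun u => HHdot u e`_j) (fun u u' => HHdotDl u u' _) (id1 := 0)).
    by apply: eq_bigr => i _; rewrite HHdotZl eG !mxE.
  by rewrite -(scale0r 0) HHdotZl mul0r.
have uGR : map_mx (intr : int -> R) G \in unitmx.
  by rewrite unitmxE det_map_mx rmorph_unit // -unitmxE.
move: H => /(canRL (mulmxK uGR)); rewrite mul0mx => /rowP H i.
by move: (H i); rewrite !mxE.
Qed.

Theorem proposition3 (R : realType) (A : falgType rat)
  (hA : quaternion_algebra A)
  (iota : {rmorphism A -> quat R}) (hiota : scalar_extension iota)
  (O : set A) (hO : maximal_order O) :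
  exists L : set (HH R),
    O_lattice iota O L /\
    isometric (@HHdot R) (@dot R 8) L (@E8 R).
Proof.
have [tr [htr trE]] := exists_trace hiota.
have iZ := iotaZ iota.
have iI := iota_inj hiota.
have nc := quaternion_noncomm hA; have [dimA _ _] := hA.
have [d dE] := exists_dual_exponent htr hO; have [d0 hd _] := dE.
have [b [k [db _ hb]]] := partial_twist htr hO nc dE (dvdnn d).
have dQ0 : d%:R != 0 :> rat by rewrite pnatr_eq0 -lt0n.
have {}hb : norm_of tr b + d%:R^-1 \is a Num.int.
  have -> : norm_of tr b + d%:R^-1 = k%:~R; last exact: intr_int.
  by apply: (mulfI dQ0); rewrite -hb mulrDr mulfV.
have [P [G [[[uG pG eG] tG PO] OP]]] := tform_unimodular htr hO nc dimA d0 hd db hb.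
pose s : R := (Num.sqrt d%:R)^-1.
have s2 : s ^+ 2 = ratr d%:R^-1.
  by rewrite fmorphV /= ratr_nat exprVn sqr_sqrtr ?ler0n.
have s0 : s != 0.
  by rewrite invr_eq0 sqrtr_eq0 -ltNge ltr0n.
pose V (u : A * A) : HH R := (iota (twist b u), s *: iota u.2).
have cE x : iota (conj_of tr x) = qconj (iota x).
  rewrite /conj_of rmorphB iZ rmorph1 trE.
  by case: (iota x) => a1 a2 a3 a4; rewrite /qtrace; apply: quatP => /=; ring.
have Vdot u v : HHdot (V u) (V v) = ratr (tform tr d b u v).
  rewrite /tform rmorphD rmorphM /= !trE !rmorphM !cE -s2 /HHdot /V /=.
  congr (_ + _); move: (iota u.2) (iota v.2) => [? ? ? ?] [? ? ? ?].
  by rewrite /qtrace /=; ring.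
have VD u v : V (u + v) = V u + V v.
  have tD : twist b (u + v) = twist b u + twist b v.
    by rewrite /twist mulrDr addrACA.
  by rewrite /V tD (rmorphD iota (twist b u)) (rmorphD iota u.2) scalerDr.
have V0 : V 0 = 0 by apply: (addrI (V 0)); rewrite -VD !addr0.
(* T sends integer coordinates to the lattice spanned over O by (1, 0) and
   (b, 1 / sqrt d). *)
pose T (n : 'rV[int]_8) := V (\sum_j P j *~ n 0 j).
have Tdot n m : HHdot (T n) (T m) = (gdot G n m)%:~R.
  by rewrite Vdot tG ratr_int.
have TD n m : T (n + m) = T n + T m.
  rewrite /T -VD; congr V; rewrite -big_split; apply: eq_bigr => j _.
  by rewrite mxE mulrzDr.
have T0 : T 0 = 0 by apply: (addrI (T 0)); rewrite -TD !addr0.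
have Tinj : injective T.
  move=> n m nm; apply/eqP; rewrite -subr_eq0; apply: contraT => nm0.
  have := posdef_ratP pG nm0; rewrite -(ltr0z R) -Tdot.
  suff -> : T (n - m) = 0 by rewrite -(scale0r 0) HHdotZl mul0r ltxx.
  by apply: (addIr (T m)); rewrite -TD subrK nm add0r.
pose L : set (HH R) := [set v | exists n, v = T n]%classic.
have TE n : T n = \sum_j T (delta_mx 0 j) *~ n 0 j.
  have TMz m (z : int) : T (z *: m) = T m *~ z.
    have TN x : T (- x) = - T x by apply: (addrI (T x)); rewrite -TD !subrr.
    have Tn x q : T (x *+ q) = T x *+ q.
      by elim: q => // q IH; rewrite !mulrS TD IH.
    rewrite -[z]intz scaler_int; case: z => q; rewrite ?intz.
      exact: Tn.
    by rewrite NegzE !mulrNz TN Tn.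
  rewrite {1}[n]row_sum_delta (big_morph T TD T0).
  by apply: eq_bigr => j _; rewrite TMz.
have [phi [phiD phidot phiE phiS]] := even_unimodular8_E8 R uG pG eG.
exists L; split; [split|].
- pose e := [tuple T (delta_mx 0 j) | j < 8].
  have eE (j : 'I_8) : e`_j = T (delta_mx 0 j) by rewrite -tnth_nth tnth_mktuple.
  rewrite /zlattice dim_HH; exists e; split.
    apply: (gram_basis uG) => i j; rewrite !eE Tdot; congr (_%:~R).
    by rewrite /gdot -rowE trmx_delta -colE !mxE.
  apply/seteqP; split=> v /= [n ->].
    by exists [ffun j => n 0 j]; rewrite TE; apply: eq_bigr => j _; rewrite ffunE eE.
  by exists (\row_j n j); rewrite TE; apply: eq_bigr => j _; rewrite mxE eE.
- exists (fun i : 'I_2 => if i == 0 then (1, 0) else (iota b, s *: 1)).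
  have sumV (a : 'I_2 -> A) :
    \sum_(i < 2) HHscale (if i == 0 then (1, 0) else (iota b, s *: 1)) (iota (a i)) =
    V (a 0, a 1).
    have l1 : lift ord0 ord0 = 1 :> 'I_2 by exact: val_inj.
    rewrite big_ord_recl big_ord1 l1 /HHscale /V /= mul1r mul0r; congr pair => /=.
      by rewrite /twist /= rmorphD rmorphM.
    by rewrite add0r -scalerAl mul1r.
  split.
    apply/seteqP; split=> v /=.
      move=> [n ->]; have [O1 O2] := OP n; set u := \sum_j _ in O1 O2 *.
      exists (fun i : 'I_2 => if i == 0 then u.1 else u.2).
        by move=> i; case: ifP.
      by rewrite sumV /= /T -/u; case: (u).
    move=> [a Oa ->]; rewrite sumV; have [n En] := PO _ _ (Oa 0) (Oa 1).
    by exists n; rewrite /T -En.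
  move=> a _; rewrite sumV => E; move/(congr1 snd)/eqP: (E); move/(congr1 fst): E => /= e1.
  rewrite scaler_eq0 (negPf s0) /=.
  rewrite -(rmorph0 iota) (inj_eq iI) => /eqP a1.
  move: e1; rewrite /twist /= a1 mulr0 addr0 -(rmorph0 iota) => /iI a0.
  case=> -[|[|//]] i2; [rewrite -a0|rewrite -a1]; congr a; exact: val_inj.
(* The isometry inverts T on L; its values outside L are arbitrary. *)
have /choice[c hc] : forall v : HH R, exists n, L v -> v = T n.
  by move=> v; have [[n ->]|nL] := pselect (L v); [exists n | exists 0].
pose f v := phi (c v).
have fT n : f (T n) = phi n.
  rewrite /f; congr phi; apply: Tinj; rewrite -hc //; by exists n.
have phi0 : phi 0 = 0 by apply: (addrI (phi 0)); rewrite -phiD !addr0.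
exists f; split.
- split.
  + by move=> _ [n ->]; rewrite fT; exact: phiE.
  + move=> u v /set_mem[n ->] /set_mem[m ->]; rewrite !fT => nm.
    congr T; apply/eqP; rewrite -subr_eq0; apply: contraT => nm0.
    have := posdef_ratP pG nm0; rewrite -(ltr0z R) -phidot.
    suff -> : phi (n - m) = 0 by rewrite /dot mul0mx mxE ltxx.
    by apply: (addIr (phi m)); rewrite -phiD subrK nm add0r.
  by move=> v /phiS[n <-]; exists (T n); [exists n | rewrite fT].
- by move=> _ _ [n ->] [m ->]; rewrite -TD !fT phiD.
by move=> _ _ [n ->] [m ->]; rewrite !fT phidot Tdot.
Qed.
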